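(* Let $f(z)\in\mathbb{C}(z)$. The solution set in $\mathcal{U}$ of $$z''=z'f(z),\qquad z'\neq 0,$$ is strongly minimal if and only if for all $g\in\mathbb{C}(z)$ we have $f(z)\neq\frac{dg}{dz}$.
   Context: $(\mathcal{U},\delta)$ is a saturated model of $DCF_0$ (differentially closed fields of characteristic zero with a single derivation $\delta$, written $y'=\delta(y)$), whose field of constants is $\mathbb{C}$. A definable set $X$ in $\mathcal{U}^n$ (with parameters) is strongly minimal if it is infinite and for every definable subset $Y$ of $X$, either $Y$ or $X\setminus Y$ is finite. The solution set consists of the $z\in\mathcal{U}$, not a pole of $f$, satisfying both conditions. *)

(* Defs.v *)
From HB Require Import structures.
From mathcomp Require Import all_boot all_order all_algebra.
From mathcomp Require Import complex.
From mathcomp Require Import mpoly.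
From mathcomp Require Import boolp classical_sets functions cardinality reals.

Set Implicit Arguments.
Unset Strict Implicit.
Unset Printing Implicit Defensive.

Import GRing.Theory.

Local Open Scope classical_set_scope.
Local Open Scope ring_scope.

(* First-order formulas in the language (0, 1, +, -, *, delta) of differential
   rings, with parameters in K.  They are well scoped: the free variables of a
   [formula K n] are among n of them, and [Ex] binds variable 0, shifting the
   others by one. *)
Inductive term (K : Type) (n : nat) : Type :=
| Var of 'I_n
| Par of K
| Zero
| One
| Add of term K n & term K n
| Opp of term K n
| Mul of term K n & term K n
| Der of term K n.

Inductive formula (K : Type) : nat -> Type :=
| Eq n of term K n & term K n : formula K n
| Not n of formula K n : formula K n
| And n of formula K n & formula K n : formula K n
| Ex n of formula K n.+1 : formula K n.

Fixpoint tparams (K : Type) n (t : term K n) : set K :=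
  match t with
  | Par c => [set c]
  | Var _ | Zero | One => set0
  | Opp t1 | Der t1 => tparams t1
  | Add t1 t2 | Mul t1 t2 => tparams t1 `|` tparams t2
  end.

Fixpoint fparams (K : Type) n (phi : formula K n) : set K :=
  match phi with
  | Eq _ t1 t2 => tparams t1 `|` tparams t2
  | Not _ phi1 => fparams phi1
  | And _ phi1 phi2 => fparams phi1 `|` fparams phi2
  | Ex _ phi1 => fparams phi1
  end.

Fixpoint teval (K : fieldType) (delta : K -> K) n (x : n.-tuple K)
    (t : term K n) : K :=
  match t with
  | Var i => tnth x i
  | Par c => c
  | Zero => 0
  | One => 1
  | Add t1 t2 => teval delta x t1 + teval delta x t2
  | Opp t1 => - teval delta x t1
  | Mul t1 t2 => teval delta x t1 * teval delta x t2
  | Der t1 => delta (teval delta x t1)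
  end.

Fixpoint holds (K : fieldType) (delta : K -> K) n (phi : formula K n) :
    n.-tuple K -> Prop :=
  match phi with
  | Eq _ t1 t2 => fun x => teval delta x t1 = teval delta x t2
  | Not _ phi1 => fun x => ~ holds delta phi1 x
  | And _ phi1 phi2 => fun x => holds delta phi1 x /\ holds delta phi2 x
  | Ex _ phi1 => fun x => exists y : K, holds delta phi1 [tuple of y :: x]
  end.

Definition definable (K : fieldType) (delta : K -> K) n
    (X : set (n.-tuple K)) : Prop :=
  exists phi : formula K n, X = [set x | holds delta phi x].

Definition strongly_minimal (K : fieldType) (delta : K -> K) n
    (X : set (n.-tuple K)) : Prop :=
  [/\ definable delta X,
      infinite_set X &
      forall Y : set (n.-tuple K), definable delta Y -> Y `<=` X ->
        finite_set Y \/ finite_set (X `\` Y)].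

Definition is_derivation (K : fieldType) (delta : K -> K) : Prop :=
  (forall x y, delta (x + y) = delta x + delta y) /\
  (forall x y, delta (x * y) = delta x * y + x * delta y).

(* (x, x', ..., x^(n-1)) *)
Definition jet (K : fieldType) (delta : K -> K) n (x : K) : 'I_n -> K :=
  fun i => iter i delta x.

(* Blum's axioms.  A differential polynomial of order at most n is an element
   of K[X, X', ..., X^(n)], i.e. of {mpoly K[n.+1]}; it has order exactly n when
   X^(n) occurs in it.  An element g of {mpoly K[n]} thus has order < n (for
   n = 0 it is a constant, of order -1 by convention). *)
Definition blum_axioms (K : fieldType) (delta : K -> K) : Prop :=
  forall n (f : {mpoly K[n.+1]}) (g : {mpoly K[n]}),
    (exists2 m, m \in msupp f & m ord_max != 0%N) -> g != 0 ->
    exists x : K, f.@[jet delta x] = 0 /\ g.@[jet delta x] != 0.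

Definition model_of_DCF0 (K : fieldType) (delta : K -> K) : Prop :=
  [/\ [pchar K] =i pred0, is_derivation delta & blum_axioms delta].

(* Every type, in finitely many variables, over a set A of parameters with
   |A| < |K| (that is, K does not inject into A) is realized in K. *)
Definition saturated (K : fieldType) (delta : K -> K) : Prop :=
  forall n (A : set K) (p : set (formula K n)),
    ~~ ([set: K] #<= A)%card ->
    (forall phi, p phi -> fparams phi `<=` A) ->
    (forall q : set (formula K n), finite_set q -> q `<=` p ->
       exists x, forall phi, q phi -> holds delta phi x) ->
    exists x, forall phi, p phi -> holds delta phi x.

(* Numerator and denominator of a rational function in lowest terms (unique
   up to a common constant factor). *)
Definition rnum (C : fieldType) (f : {fraction {poly C}}) : {poly C} :=
  let r := repr f in \n_r %/ gcdp \n_r \d_r.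
Definition rden (C : fieldType) (f : {fraction {poly C}}) : {poly C} :=
  let r := repr f in \d_r %/ gcdp \n_r \d_r.

(* dg/dz, by the quotient rule. *)
Definition rderiv (C : fieldType) (g : {fraction {poly C}}) :
    {fraction {poly C}} :=
  (tofrac ((rnum g)^`() * rden g - rnum g * (rden g)^`()))
    / (tofrac (rden g ^+ 2)).

Definition pole (C K : fieldType) (iota : {rmorphism C -> K})
    (f : {fraction {poly C}}) (z : K) : Prop :=
  (map_poly iota (rden f)).[z] = 0.

Definition reval (C K : fieldType) (iota : {rmorphism C -> K})
    (f : {fraction {poly C}}) (z : K) : K :=
  (map_poly iota (rnum f)).[z] / (map_poly iota (rden f)).[z].

Definition solution_set (C K : fieldType) (iota : {rmorphism C -> K})
    (delta : K -> K) (f : {fraction {poly C}}) : set K :=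
  [set z | [/\ ~ pole iota f z,
               delta (delta z) = delta z * reval iota f z &
               delta z != 0]].

(* Main.v *)
From HB Require Import structures.
Require Import Defs.
From mathcomp Require Import all_boot all_order all_algebra.
From mathcomp Require Import complex.
From mathcomp Require Import mpoly.
From mathcomp Require Import boolp classical_sets functions cardinality reals.
From mathcomp Require Import ring.

(** Let z be a solution of z'' = z' f(z), z' <> 0, that is transcendental over a
    differential field k containing the coefficients of f.

    Suppose that u = z' is algebraic over k(z). Taking the trace and the norm of u
    over k(z) in u' = u f(z), one finds a positive multiple of f as the sum of the
    derivative dS/dz of a rational function and of logarithmic derivatives of elements
    of k[z] with respect to delta acting on the coefficients ([order_one_relation]).
    At a point a of the constant field C the logarithmic derivatives are regular
    ([log_derivative_regular]) and dS/dz cannot have a simple pole ([no_simple_pole]).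
    Unless f is a derivative, Hermite reduction ([hermite_reduction]) writes it as a
    derivative plus a function with a simple pole at some a in C, which these two
    facts exclude. So f = dg/dz for some g in C(z) ([order_one_integrable]).

    Thus, if f is not a derivative, each solution is either algebraic over k or
    generic, in the sense that z and z' are algebraically independent over k. For a
    generic z, all differential relations over k follow from the equation, so any two
    generic solutions have the same quantifier-free type over k
    ([generic_solutions_same_type]), hence satisfy the same formulas over k
    ([same_type_holds]). Given a definable subset Y of the solution set, take for k
    the differential field generated by the parameters of Y and the coefficients of f:
    either Y or its complement contains no generic solution, and that set is finite
    because, by saturation, its points are roots of one polynomial over k
    ([finite_without_generic]).

    The agreement of formulas on tuples of the same quantifier-free type is a
    back-and-forth argument. A partial isomorphism is a correspondence between two
    differential subrings of U; its extension to one more element w ([extension]) is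
    either purely transcendental or governed by a minimal relation of w
    ([transcendental_extension], [algebraic_extension]); Blum's axioms with saturation
    provide the image of w.

    Conversely, if f = dg/dz then z' - g(z) is constant on solutions, and the sets z'
    = g(z) + c, for two suitable constants c, are disjoint infinite definable subsets
    ([integrable_not_strongly_minimal]). *)

Set Implicit Arguments.
Unset Strict Implicit.
Unset Printing Implicit Defensive.

Import GRing.Theory.

Local Open Scope classical_set_scope.
Local Open Scope ring_scope.

(** * Rational functions and their derivative *)

Section RationalFunctions.
Variable F : fieldType.
Implicit Types (p q n d u : {poly F}) (g : {fraction {poly F}}).

Local Notation "p %:T" := (@tofrac {poly F} p).

Lemma fracE g : g = (\n_(repr g))%:T / (\d_(repr g))%:T.
Proof.
have d0 := denom_ratioP (repr g).
apply: (canRL (mulfK _)); first by rewrite tofrac_eq0.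
rewrite -{1}[g]reprK; move: (repr g) d0 => r r0.
unlock tofrac; rewrite -[LHS]FracField.pi_mul; apply/eqmodP.
by rewrite /= FracField.equivfE /FracField.mulf !numden_Ratio ?mulr1 ?oner_eq0 // mulrC.
Qed.

Lemma rden_neq0 g : rden g != 0.
Proof.
have d0 := denom_ratioP (repr g).
apply: contraNneq d0; rewrite /rden => r0.
by rewrite -(divpK (dvdp_gcdr (\n_(repr g)) (\d_(repr g)))) r0 mul0r.
Qed.

Lemma coprime_rnum_rden g : coprimep (rnum g) (rden g).
Proof. by rewrite /rnum /rden coprimep_div_gcd // denom_ratioP orbT. Qed.

(** Passing to lowest terms divides numerator and denominator by the same gcd. *)
Lemma rnum_rdenE g : g = (rnum g)%:T / (rden g)%:T.
Proof.
have d0 := denom_ratioP (repr g).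
have r0 := rden_neq0 g.
rewrite [LHS]fracE; apply/eqP; rewrite eqr_div ?tofrac_eq0 //.
rewrite -!tofracM tofrac_eq; apply/eqP.
have en := divpK (dvdp_gcdl (\n_(repr g)) (\d_(repr g))).
have ed := divpK (dvdp_gcdr (\n_(repr g)) (\d_(repr g))).
rewrite -/(rnum g) in en; rewrite -/(rden g) in ed.
by rewrite -[X in X * _ = _]en -[X in _ = _ * X]ed; ring.
Qed.

(** The derivative is defined on the fraction in lowest terms a / b; differentiating a
    d = n b shows that the quotient rule gives the same value on n / d. *)
Lemma rderiv_frac n d : d != 0 ->
  rderiv (n%:T / d%:T) = (n^`() * d - n * d^`())%:T / (d ^+ 2)%:T.
Proof.
move=> d0; set g := n%:T / d%:T.
have b0 := rden_neq0 g; have := rnum_rdenE g; rewrite /rderiv.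
move: (rnum g) (rden g) b0 => a b b0 /eqP.
rewrite eqr_div ?tofrac_eq0 // -!tofracM tofrac_eq => /eqP e.
apply/eqP; rewrite eqr_div ?tofrac_eq0 ?expf_neq0 // -!tofracM tofrac_eq; apply/eqP.
have := congr1 (@deriv F) e; rewrite !derivM => e'.
have -> : (a^`() * b - a * b^`()) * d ^+ 2 = b * d * (a^`() * d + a * d^`()) - a * d * (b * d^`() + d * b^`()) by ring.
have -> : (n^`() * d - n * d^`()) * b ^+ 2 = b * d * (n^`() * b + n * b^`()) - n * b * (b * d^`() + d * b^`()) by ring.
by rewrite e e'.
Qed.

Lemma frac_exists g : exists n d, d != 0 /\ g = n%:T / d%:T.
Proof. by exists (rnum g), (rden g); rewrite rden_neq0 -rnum_rdenE. Qed.

Lemma rderivD g h : rderiv (g + h) = rderiv g + rderiv h.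
Proof.
have [n [d [d0 ->]]] := frac_exists g; have [m [e [e0 ->]]] := frac_exists h.
rewrite addf_div ?tofrac_eq0 // -!tofracM -tofracD !rderiv_frac ?mulf_neq0 //.
rewrite addf_div ?tofrac_eq0 ?expf_neq0 // -!tofracM -tofracD.
apply/eqP; rewrite eqr_div ?tofrac_eq0 ?expf_neq0 ?mulf_neq0 ?expf_neq0 //.
rewrite -!tofracM tofrac_eq !(derivD, derivM); apply/eqP; ring.
Qed.

End RationalFunctions.

(** * Hermite reduction *)

Section Hermite.
Variable F : closedFieldType.
Hypothesis char0 : [pchar F] =i pred0.
Implicit Types (p q : {poly F}) (g : {fraction {poly F}}).

Local Notation "p %:T" := (@tofrac {poly F} p).

Lemma natf_neq0 n : (n.+1%:R : F) != 0.
Proof. by move/pcharf0P: char0 => ->. Qed.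

Lemma poly_antiderivative p : exists q, q^`() = p.
Proof.
exists (\poly_(i < (size p).+1) (p`_i.-1 / i%:R)).
apply/polyP => i; rewrite coef_deriv coef_poly ltnS.
have [lip|lpi] := ltnP i (size p); last by rewrite mul0rn nth_default.
by rewrite -[LHS]mulr_natr divfK ?natf_neq0.
Qed.

(** Induction on the degree of the denominator. At a root r of multiplicity m + 2,
    subtracting the derivative of c / (X - r)^(m + 1) for the right constant c makes
    the numerator vanish at r, which lowers the multiplicity. The process stops either
    at a polynomial, which has an antiderivative, or at a simple pole a, which is the
    obstruction to integrating p / q. *)
Lemma hermite_reduction p q : q != 0 ->
  (exists g, p%:T / q%:T = rderiv g) \/
  exists g a p1 q1, [/\ p1.[a] != 0, q1.[a] != 0 &
    p%:T / q%:T = rderiv g + p1%:T / (('X - a%:P) * q1)%:T].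
Proof.
have [N] := ubnP (size q); elim: N p q => // N IH p q; rewrite ltnS => sq q0.
have [sq1|sq1] := leqP (size q) 1.
  move: q0; rewrite (size1_polyC sq1) polyC_eq0; move: (q`_0) => c c0; left.
  have [u Hu] := poly_antiderivative (c^-1 *: p).
  exists (u%:T / 1%:T).
  rewrite rderiv_frac ?oner_eq0 // Hu derivC mulr0 subr0 mulr1 expr1n.
  apply/eqP; rewrite eqr_div ?tofrac_eq0 ?oner_eq0 ?polyC_eq0 // -!tofracM tofrac_eq.
  by rewrite mulr1 mulrC mul_polyC scalerA divff // scale1r.
have /closed_rootP [r /factor_theorem [q' eq]] : size q != 1 by rewrite neq_ltn sq1 orbT.
have X0 : 'X - r%:P != 0 by rewrite polyXsubC_eq0.
have q'0 : q' != 0 by apply: contraNneq q0 => q'0; rewrite eq q'0 mul0r.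
have sq' : (size q' < N)%N.
  by apply: leq_trans sq; rewrite eq size_mul // size_XsubC addn2.
have [/factor_theorem [p' ep]|pr] := boolP (root p r).
  have -> : p%:T / q%:T = p'%:T / q'%:T.
    apply/eqP; rewrite eqr_div ?tofrac_eq0 // -!tofracM tofrac_eq eq ep; apply/eqP.
    ring.
  exact: IH.
have [q'r|q'r] := boolP (root q' r); last first.
  right; exists (0%:T / 1%:T), r, p, q'; split=> //.
  by rewrite rderiv_frac ?oner_eq0 // deriv0 !mul0r subrr tofrac0 mul0r add0r eq [q' * _]mulrC.
have [m [q1 q1r eq1]] := multiplicity_XsubC q' r.
move: q1r; rewrite q'0 /= => q1r.
case: m eq1 => [|m] eq1; first by rewrite eq1 expr0 mulr1 (negPf q1r) in q'r.
have q10 : q1 != 0 by apply: contraNneq q1r => ->; rewrite root0.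
(* c cancels the coefficient of (X - r)^-(m + 2) *)
pose c := - p.[r] / (m.+1%:R * q1.[r]).
have c0 : m.+1%:R * q1.[r] != 0 by rewrite mulf_neq0 ?natf_neq0.
have ec : m.+1%:R * c * q1.[r] = - p.[r] by rewrite mulrAC mulrC /c divfK.
have /factor_theorem [p' ep'] : root (p + (m.+1%:R * c)%:P * q1) r.
  by rewrite rootE hornerD hornerM hornerC ec subrr.
rewrite rmorphM rmorph_nat /= in ep'.
pose w := ('X - r%:P) ^+ m.+1.
have w0 : w != 0 by rewrite expf_neq0.
have dw : w^`() = m.+1%:R * ('X - r%:P) ^+ m.
  by rewrite deriv_exp derivXsubC mul1r mulr_natl.
have sw : (size (w * q1)%R < N)%N by rewrite /w mulrC -eq1.
have := IH p' (w * q1) sw (mulf_neq0 w0 q10).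
have -> : p%:T / q%:T = rderiv (c%:P%:T / w%:T) + p'%:T / (w * q1)%:T.
  rewrite rderiv_frac // derivC mul0r sub0r addf_div ?tofrac_eq0 ?expf_neq0 ?mulf_neq0 //.
  rewrite -!tofracM -tofracD; apply/eqP.
  rewrite eqr_div ?tofrac_eq0 ?expf_neq0 ?mulf_neq0 ?expf_neq0 // -!tofracM tofrac_eq.
  have -> : p = p' * ('X - r%:P) - m.+1%:R * c%:P * q1 by rewrite -ep' addrK.
  rewrite eq eq1 dw /w expr2 !exprS; apply/eqP.
  move: (('X - r%:P) ^+ m) ('X - r%:P) (m.+1%:R : {poly F}) (c%:P) => e x t k.
  ring.
case=> [[g ->]|[g [a [p1 [r1 [p1a r1a ->]]]]]].
  by left; exists (c%:P%:T / w%:T + g); rewrite rderivD.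
by right; exists (c%:P%:T / w%:T + g), a, p1, r1; rewrite rderivD addrA.
Qed.

End Hermite.

(** * Derivations and simple poles *)

Section Derivation.
Variables (K : fieldType) (delta : K -> K).
Hypothesis der : is_derivation delta.

Lemma derD x y : delta (x + y) = delta x + delta y. Proof. by case: der. Qed.
Lemma derM x y : delta (x * y) = delta x * y + x * delta y. Proof. by case: der. Qed.

Lemma der0 : delta 0 = 0.
Proof. by apply: (addrI (delta 0)); rewrite -derD !addr0. Qed.

Lemma der1 : delta 1 = 0.
Proof. by apply: (addrI (delta 1)); rewrite addr0 -{3}[1]mulr1 derM mul1r mulr1. Qed.

Lemma derN x : delta (- x) = - delta x.
Proof. by apply: (addrI (delta x)); rewrite -derD !subrr der0. Qed.

Lemma der_sum (I : Type) (r : seq I) (P : pred I) (G : I -> K) :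
  delta (\sum_(i <- r | P i) G i) = \sum_(i <- r | P i) delta (G i).
Proof. exact: (big_morph delta derD der0). Qed.

Lemma derV x : x != 0 -> delta x^-1 = - delta x / x ^+ 2.
Proof.
move=> x0; have := derM x x^-1; rewrite divff // der1 => e.
have {e} e : x * delta x^-1 = - (delta x * x^-1).
  by apply/eqP; rewrite -addr_eq0 addrC -e.
apply: (mulfI x0); rewrite e; move: (delta x) => y; field; exact: x0.
Qed.

Local Notation D := (map_poly delta).

Lemma coef_map_der (p : {poly K}) i : (D p)`_i = delta p`_i.
Proof. by rewrite coef_map_id0 // der0. Qed.

Lemma map_derM (p q : {poly K}) : D (p * q) = D p * q + p * D q.
Proof.
apply/polyP => i; rewrite coef_map_der coefD !coefM der_sum -big_split /=.
by apply: eq_bigr => j _; rewrite derM !coef_map_der.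
Qed.

Lemma map_der_XsubC a : delta a = 0 -> D ('X - a%:P) = 0.
Proof.
move=> a0; apply/polyP => i; rewrite coef_map_der coefB coefX coefC coef0 derD derN.
by case: i => [|[|i]] /=; rewrite ?der0 ?der1 ?a0 subrr.
Qed.

Lemma map_der_XsubC_exp a n p : delta a = 0 ->
  D (('X - a%:P) ^+ n * p) = ('X - a%:P) ^+ n * D p.
Proof.
move=> a0; rewrite map_derM; suff -> : D (('X - a%:P) ^+ n) = 0 by rewrite mul0r add0r.
elim: n => [|n IH]; last by rewrite exprS map_derM IH map_der_XsubC // mul0r mulr0 addr0.
by apply/polyP => i; rewrite expr0 coef_map_der coef1 coef0; case: i => [|i]; rewrite ?der0 ?der1.
Qed.

Local Notation "p %:T" := (@tofrac {poly K} p).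

(** A constant a makes delta(X - a) vanish, so the powers of X - a dividing p cancel
    in the logarithmic derivative of p. *)
Lemma log_derivative_regular a p : delta a = 0 -> p != 0 ->
  exists A P, P.[a] != 0 /\ (D p)%:T / p%:T = A%:T / P%:T.
Proof.
move=> a0 p0; have [m [P /implyP/(_ p0) Pa ep]] := multiplicity_XsubC p a.
exists (D P), P; split=> //.
have P0 : P != 0 by apply: contraNneq Pa => ->; rewrite root0.
apply/eqP; rewrite eqr_div ?tofrac_eq0 // -!tofracM tofrac_eq ep mulrC.
by rewrite mulrC [P * _]mulrC map_der_XsubC_exp //; apply/eqP; ring.
Qed.

(** The order of a pole of a derivative with respect to X is never 1, and the
    coefficientwise logarithmic derivatives have no pole at the constant a. *)
Lemma no_simple_pole a p l g p1 q1 : [pchar K] =i pred0 -> delta a = 0 ->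
  p != 0 -> l != 0 -> p1.[a] != 0 -> q1.[a] != 0 ->
  p1%:T / (('X - a%:P) * q1)%:T <> (D p)%:T / p%:T - (D l)%:T / l%:T + rderiv g.
Proof.
move=> ch a0 p0 l0 p1a q1a.
have [A [P [Pa ->]]] := log_derivative_regular a0 p0.
have [B [L [La ->]]] := log_derivative_regular a0 l0.
have nz (q : {poly K}) : q.[a] != 0 -> q != 0.
  by apply: contraNneq => ->; rewrite horner0.
have X0 : 'X - a%:P != 0 by rewrite polyXsubC_eq0.
rewrite /rderiv.
have := coprime_rnum_rden g; have r0 := rden_neq0 g.
move: (rnum g) (rden g) r0 => s r r0 cp.
have [m [r1 /implyP/(_ r0) r1a er]] := multiplicity_XsubC r a.
rewrite rootE in r1a.
have P0 := nz _ Pa; have L0 := nz _ La; have Q0 := nz _ q1a.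
have PL0 := mulf_neq0 P0 L0; have XQ0 := mulf_neq0 X0 Q0.
have rr0 : r ^+ 2 != 0 by rewrite expf_neq0.
rewrite -mulNr -tofracN addf_div ?tofrac_eq0 // -!tofracM -tofracD.
rewrite addf_div ?tofrac_eq0 // -!tofracM -tofracD.
move/eqP; rewrite eqr_div ?tofrac_eq0 ?(mulf_neq0 PL0) // -!tofracM tofrac_eq => /eqP.
set x := 'X - a%:P; have xa : x.[a] = 0 by rewrite hornerXsubC subrr.
have dx : x^`() = 1 by rewrite derivXsubC.
rewrite -/x in X0 XQ0 er; clearbody x.
(* m is the order of the pole of g at a *)
case: m er => [|m] er.
  rewrite er expr0 mulr1 => /(congr1 (horner^~ a)) /eqP.
  rewrite !(mulrA _ x) [_ * x]mulrC -!mulrA [(x * _).[a]]hornerM xa mul0r !hornerM.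
  by rewrite !mulf_eq0 (negPf p1a) (negPf Pa) (negPf La) (negPf r1a).
have sa : s.[a] != 0.
  apply: contraTneq cp => sa; apply/negP => /coprimep_root /(_ (introT eqP sa)).
  by rewrite er exprS !hornerM xa mul0r mulr0 eqxx.
(* rderiv g = W / (x ^ (m + 2) r1 ^ 2), where W does not vanish at a *)
pose W := x * s^`() * r1 - s * (m.+1%:R * r1 + x * r1^`()).
have eW : s^`() * r - s * r^`() = x ^+ m * W.
  rewrite er derivM deriv_exp dx mul1r /W -mulr_natl exprS.
  by move: (x ^+ m) => xm; ring.
have Wa : W.[a] = - (s.[a] * (m.+1%:R * r1.[a])).
  rewrite /W !(hornerM, hornerD, hornerN) xa !mul0r add0r addr0.
  by rewrite -polyC_natr hornerC.
rewrite eW er => e.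
have {e} : x ^+ m.+1 * (p1 * P * L * r1 ^+ 2) = x ^+ m.+2 * q1 * r1 ^+ 2 * (A * L - B * P) + W * q1 * P * L.
  have : x ^+ m.+1 != 0 by rewrite expf_neq0.
  move/mulfI; apply; move: e; rewrite !expr2 !exprS; move: (x ^+ m) => y e.
  transitivity (p1 * (P * L * (r1 * (x * y) * (r1 * (x * y))))); first by ring.
  by rewrite e; ring.
move/(congr1 (horner^~ a)) => /eqP.
rewrite !exprS -!mulrA hornerM xa mul0r hornerD [(x * _).[a]]hornerM xa mul0r add0r.
rewrite !hornerM Wa eq_sym !mulf_eq0 oppr_eq0 !mulf_eq0 (negPf sa) (negPf r1a) (negPf q1a) (negPf Pa) (negPf La).
by move/pcharf0P: ch => ->.
Qed.
End Derivation.

(** * The order-one relation *)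

Lemma ex_minimizer (T : Type) (f : T -> nat) (P : T -> Prop) :
  (exists x, P x) -> exists2 x, P x & forall y, P y -> (f x <= f y)%N.
Proof.
case=> x0; have [N] := ubnP (f x0); elim: N x0 => // N IH x0; rewrite ltnS => le Px.
have [[y Py ltyx]|no] := pselect (exists2 y, P y & (f y < f x0)%N).
  exact: (IH y (leq_trans ltyx le) Py).
by exists x0 => // y Py; rewrite leqNgt; apply/negP => lt; apply: no; exists y.
Qed.

Section DerHorner.
Variables (K : fieldType) (delta : K -> K).
Hypothesis der : is_derivation delta.

(** The chain rule: map_poly delta differentiates the coefficients. *)
Lemma der_horner (p : {poly K}) x :
  delta p.[x] = (map_poly delta p).[x] + p^`().[x] * delta x.
Proof.
elim/poly_ind: p => [|p c IH].
  by rewrite map_poly0 deriv0 !horner0 (der0 der) mul0r addr0.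
have -> : map_poly delta (p * 'X + c%:P) = map_poly delta p * 'X + (delta c)%:P.
  apply/polyP => i; rewrite coef_map_der // !coefD !coefMX !coefC derD //.
  by case: i => [|i] /=; rewrite ?(der0 der) ?(coef_map_der der).
rewrite !derivD derivM derivX derivC mulr1 addr0 !hornerE derD // derM // IH.
by ring.
Qed.
End DerHorner.

Section EvalMorphism.
Variables (k U : comNzRingType) (iota : {rmorphism k -> U}) (z : U).

Definition eval_at (p : {poly k}) : U := (map_poly iota p).[z].

Lemma eval_at_is_zmod_morphism : zmod_morphism eval_at.
Proof. by move=> p q; rewrite /eval_at rmorphB hornerD hornerN. Qed.
Lemma eval_at_is_monoid_morphism : monoid_morphism eval_at.
Proof. by split=> [|p q]; rewrite /eval_at ?rmorph1 ?hornerC // rmorphM hornerM. Qed.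
HB.instance Definition _ :=
  GRing.isZmodMorphism.Build {poly k} U eval_at eval_at_is_zmod_morphism.
HB.instance Definition _ :=
  GRing.isMonoidMorphism.Build {poly k} U eval_at eval_at_is_monoid_morphism.
End EvalMorphism.

Section OrderOne.
Variables (U : fieldType) (delta : U -> U) (k : fieldType) (iota : {rmorphism k -> U}).
Variable D : k -> k.
Hypothesis der : is_derivation delta.
Hypothesis iotaD : forall c, iota (D c) = delta (iota c).
Variables (z : U) (N M : {poly k}).
Let u := delta z.
Local Notation ev := (eval_at iota z).
Hypothesis trz : forall p, p != 0 -> ev p != 0.
Hypothesis u0 : u != 0.
Hypothesis M0 : M != 0.
Hypothesis eqz : ev M * delta u = u * ev N.

Let D0 : D 0 = 0.
Proof. by apply: (fmorph_inj iota); rewrite iotaD !rmorph0 (der0 der). Qed.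

Lemma der_ev p : delta (ev p) = ev (map_poly D p) + ev p^`() * u.
Proof.
rewrite /eval_at der_horner // deriv_map; congr (_.[z] + _).
apply/polyP => i; rewrite coef_map_der // !coef_map /=.
by rewrite -iotaD coef_map_id0.
Qed.

Let EV (P : {poly {poly k}}) : U := (map_poly ev P).[u].

Let EVD P Q : EV (P + Q) = EV P + EV Q.
Proof. by rewrite /EV rmorphD hornerD. Qed.
Let EVM P Q : EV (P * Q) = EV P * EV Q.
Proof. by rewrite /EV rmorphM hornerM. Qed.
Let EVN P : EV (- P) = - EV P.
Proof. by rewrite /EV rmorphN hornerN. Qed.
Let EVX : EV 'X = u.
Proof. by rewrite /EV map_polyX hornerX. Qed.
Let EVC p : EV p%:P = ev p.
Proof. by rewrite /EV map_polyC hornerC. Qed.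

(** Let P be a polynomial of least degree d + 1 over k[z] that vanishes at u = z'.
    Differentiating P(z, u) = 0 and using M(z) u' = u N(z) gives another polynomial Q
    vanishing at u. The multiple of X P that removes its leading term leaves a
    polynomial of the same degree as P, hence proportional to P; the proportion can be
    read off at the top and at the bottom coefficient. With p, m and l the
    coefficients of degree 0, d and d + 1 of P, the resulting identity says that (d +
    1) N / M = delta(p) / p - delta(l) / l - (m / l)'. In other words, it compares the
    trace and the norm of u over k(z). *)
Lemma order_one_relation (P0 : {poly {poly k}}) : P0 != 0 -> EV P0 = 0 ->
  exists d (p l m : {poly k}), [/\ p != 0, l != 0 &
    p * (l * M * map_poly D l + l * M * m^`() + d.+1%:R * N * l ^+ 2 - M * l^`() * m)
    = l ^+ 2 * M * map_poly D p].
Proof.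
move=> P00 eP0.
have [P [{P0 P00 eP0} P0 eP] minP] := @ex_minimizer _ (fun P : {poly {poly k}} => size P)
  (fun P => P != 0 /\ EV P = 0) (ex_intro _ P0 (conj P00 eP0)).
case sP : (size P) => [|[|d]].
- by move/eqP: sP; rewrite size_poly_eq0 (negPf P0).
- have eC : P = (P`_0)%:P by apply: size1_polyC; rewrite sP.
  move: P0 eP; rewrite eC EVC polyC_eq0 => /trz /eqP; by [].
have l0 : P`_d.+1 != 0 by rewrite -[d.+1]/(d.+2.-1) -sP -lead_coefE lead_coef_eq0.
set l := P`_d.+1 in l0.
exists d, P`_0, l, P`_d.
have p0 : P`_0 != 0.
  apply/eqP => p0.
  have /factor_theorem [Q eQ] : root P 0 by rewrite rootE horner_coef0 p0.
  rewrite polyC0 subr0 in eQ.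
  have Q0 : Q != 0 by apply: contraNneq P0 => Q0; rewrite eQ Q0 mul0r.
  have := minP Q; rewrite eQ size_mulX // ltnn => H.
  suff // : false by []; apply: H; split=> //.
  by move/eqP: eP; rewrite eQ EVM EVX mulf_eq0 (negPf u0) orbF => /eqP.
split=> //.
pose Dz : {poly {poly k}} -> {poly {poly k}} := map_poly (@deriv k).
pose Dk : {poly {poly k}} -> {poly {poly k}} := map_poly (map_poly D).
have Dkc i : (Dk P)`_i = map_poly D P`_i by rewrite coef_map_id0 // map_poly0.
have Dzc i : (Dz P)`_i = (P`_i)^`() by rewrite coef_map_id0 // deriv0.
have dEV : delta (EV P) = EV (Dk P) + EV (Dz P) * u + EV P^`() * delta u.
  rewrite /EV der_horner // deriv_map; congr (_ + _).
  rewrite mulrC -hornerZ -hornerD; congr (_.[_]).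
  apply/polyP => i; rewrite coef_map_der // coefD coefZ !coef_map /= Dkc ?Dzc.
  by rewrite der_ev mulrC.
pose Q := M%:P * (Dk P + 'X * Dz P) + N%:P * ('X * P^`()).
have Q0 : EV Q = 0.
  rewrite /Q !(EVD, EVM, EVX, EVC).
  transitivity (ev M * (EV (Dk P) + EV (Dz P) * u) + EV P^`() * (u * ev N)); first by ring.
  by rewrite -eqz mulrCA -mulrDr -dEV eP (der0 der) mulr0.
have Qc j : Q`_j.+1 = M * (map_poly D P`_j.+1 + (P`_j)^`()) + j.+1%:R * N * P`_j.+1.
  rewrite /Q coefD !coefCM coefD !coefXM /= Dkc Dzc coef_deriv -mulr_natl; ring.
have Qc0 : Q`_0 = M * map_poly D P`_0.
  by rewrite /Q coefD !coefCM coefD !coefXM /= Dkc mulr0 !addr0.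
pose Q1 := l%:P * Q - (M * l^`())%:P * ('X * P).
have Q1c j : Q1`_j.+1 = l * Q`_j.+1 - M * l^`() * P`_j.
  by rewrite /Q1 coefB !coefCM coefXM.
pose c := Q1`_d.+1.
pose Q2 := l%:P * Q1 - c%:P * P.
have EQ2 : EV Q2 = 0.
  have EQ1 : EV Q1 = 0 by rewrite /Q1 EVD EVM Q0 EVN EVM EVM eP !mulr0 oppr0 addr0.
  by rewrite /Q2 EVD EVM EQ1 EVN EVM eP !mulr0 oppr0 addr0.
have P_hi j : P`_(d.+2 + j) = 0 by rewrite nth_default // sP leq_addr.
have Q2_0 : Q2 = 0.
  apply/eqP; apply: contraT => Q20.
  (* Q2 vanishes at u and has smaller degree than P *)
  have := minP Q2 (conj Q20 EQ2); rewrite leqNgt sP => /negP [].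
  rewrite ltnS; apply/leq_sizeP => j dj; rewrite /Q2 coefB !coefCM.
  have [->|ne] := eqVneq j d.+1; first by rewrite -/c -/l mulrC subrr.
  have {ne dj} : (d.+2 <= j)%N by rewrite ltn_neqAle eq_sym ne.
  move/subnKC <-; rewrite P_hi mulr0 subr0 addSn Q1c Qc -addSn P_hi.
  case: (j - d.+2)%N => [|i].
    by rewrite addn0 -/l map_poly0 add0r mulr0 addr0; ring.
  rewrite addnS -addSn P_hi map_poly0 deriv0; ring.
have := congr1 (fun q : {poly {poly k}} => q`_0) Q2_0.
rewrite coef0 /Q2 coefB !coefCM {1}/Q1 coefB !coefCM coefXM /= Qc0 /c Q1c Qc -/l.
rewrite mulr0 subr0 => /eqP; rewrite subr_eq0 => /eqP e.
transitivity (l * (l * (M * map_poly D P`_0))); last by ring.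
rewrite e mulrC; congr (_ * _).
rewrite expr2; move: (map_poly D l) (P`_d)^`() (l^`()) (P`_d) (d.+1%:R : {poly k}) => a b b' b'' n.
ring.
Qed.
End OrderOne.

Lemma map_poly_frac (C U : fieldType) (iota : {rmorphism C -> U})
    (p1 q1 p2 q2 p3 q3 : {poly C}) :
  q1 != 0 -> q2 != 0 -> q3 != 0 ->
  tofrac p1 / tofrac q1 = tofrac p2 / tofrac q2 + tofrac p3 / tofrac q3 ->
  tofrac (map_poly iota p1) / tofrac (map_poly iota q1) =
  tofrac (map_poly iota p2) / tofrac (map_poly iota q2) +
  tofrac (map_poly iota p3) / tofrac (map_poly iota q3).
Proof.
move=> q10 q20 q30.
have nz (q : {poly C}) : q != 0 -> map_poly iota q != 0 by rewrite map_poly_eq0.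
rewrite !addf_div ?tofrac_eq0 ?nz // -!tofracM -!tofracD => /eqP.
rewrite eqr_div ?tofrac_eq0 ?mulf_neq0 // -!tofracM tofrac_eq => /eqP e.
apply/eqP; rewrite eqr_div ?tofrac_eq0 ?mulf_neq0 ?nz //.
by rewrite -!tofracM tofrac_eq -!rmorphM -!rmorphD -rmorphM e.
Qed.

(** Field arithmetic that combines the order-one relation with the Hermite
    decomposition N / M = (n / b)' + s. *)
Lemma residue_identity (F : fieldType) (p dp l dl m M N n b t s l' m' n' b' : F) :
  p != 0 -> l != 0 -> M != 0 -> b != 0 ->
  N / M = (n' * b - n * b') / (b * b) + s ->
  p * (l * M * dl + l * M * m' + t * N * (l * l) - M * l' * m) = l * l * M * dp ->
  t * s = dp / p - dl / l +
    ((- m' * l - - m * l') / (l * l) + (- (t * n') * b - - (t * n) * b') / (b * b)).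
Proof.
move=> p0 l0 M0 b0 ef e.
have -> : s = N / M - (n' * b - n * b') / (b * b) by rewrite ef addrC addKr.
have -> : dp = p * (l * M * dl + l * M * m' + t * N * (l * l) - M * l' * m) / (l * l * M).
  by rewrite e mulrC mulKf // !mulf_neq0.
by field; rewrite p0 l0 M0 b0.
Qed.

Section GenericOrAlgebraic.
Variables (C : closedFieldType) (U : fieldType) (delta : U -> U).
Variables (iota : {rmorphism C -> U}) (f : {fraction {poly C}}).
Variables (k : fieldType) (j : {rmorphism k -> U}) (D : k -> k).
Hypothesis charC : [pchar C] =i pred0.
Hypothesis charU : [pchar U] =i pred0.
Hypothesis der : is_derivation delta.
Hypothesis iota_const : forall c, delta (iota c) = 0.
Hypothesis jD : forall c, j (D c) = delta (j c).
Variables N M : {poly k}.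
Hypothesis eN : map_poly j N = map_poly iota (rnum f).
Hypothesis eM : map_poly j M = map_poly iota (rden f).

(** Otherwise Hermite reduction leaves a simple pole of f at a constant a, whereas the
    order-one relation writes a nonzero integer multiple of f as a sum of logarithmic
    derivatives and of a derivative. *)
Lemma order_one_integrable z (P : {poly {poly k}}) :
  solution_set iota delta f z ->
  (forall p : {poly k}, p != 0 -> (map_poly j p).[z] != 0) ->
  P != 0 -> (map_poly (eval_at j z) P).[delta z] = 0 ->
  exists g, f = rderiv g.
Proof.
move=> [npole eqz z'0] trz P0 eP.
have M0 : M != 0 by rewrite -(map_poly_eq0 j) eM map_poly_eq0 rden_neq0.
have eqz' : eval_at j z M * delta (delta z) = delta z * eval_at j z N.
  rewrite /eval_at eN eM eqz /reval mulrCA; congr (_ * _).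
  by rewrite mulrC divfK //; apply/eqP.
have [d [p [l [m [p0 l0 e]]]]] := order_one_relation der jD trz z'0 eqz' P0 eP.
have [//|[g [a [p1 [q1 [p1a q1a]]]]]] := hermite_reduction charC (rnum f) (rden_neq0 f).
  by rewrite -rnum_rdenE.
have [n [b [b0 ->]]] := frac_exists g.
rewrite rderiv_frac // => ef.
have q10 : q1 != 0 by apply: contraNneq q1a => ->; rewrite horner0.
have X0 : 'X - a%:P != 0 by rewrite polyXsubC_eq0.
have := map_poly_frac iota (rden_neq0 f) (expf_neq0 2 b0) (mulf_neq0 X0 q10) ef.
rewrite -eN -eM => {}ef.
have mapD (q : {poly k}) : map_poly j (map_poly D q) = map_poly delta (map_poly j q).
  have D0 : D 0 = 0 by apply: (fmorph_inj j); rewrite jD !rmorph0 (der0 der).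
  by apply/polyP => i; rewrite coef_map_der // !coef_map /= coef_map_id0 ?jD.
move: e => /(congr1 (map_poly j)).
rewrite !(rmorphM, rmorphD, rmorphN, rmorphXn) /= rmorph_nat !mapD -!deriv_map.
have nz (q : {poly k}) : q != 0 -> map_poly j q != 0 by rewrite map_poly_eq0.
move: (nz _ p0) (nz _ l0) (nz _ M0) ef.
move: (map_poly j p) (map_poly j l) (map_poly j m) (map_poly j M) (map_poly j N).
move=> p' l' m' M' N' p'0 l'0 M'0 ef e.
have nzi (q : {poly C}) : q != 0 -> map_poly iota q != 0 by rewrite map_poly_eq0.
have dn0 : d.+1%:R != 0 :> U by move/pcharf0P: charU => ->.
case: (@no_simple_pole U delta der (iota a) p' l'
  (tofrac (- m') / tofrac l' +
   (tofrac (- (d.+1%:R * map_poly iota n)) / tofrac (map_poly iota b)))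
  (d.+1%:R * map_poly iota p1) (map_poly iota q1)) => //.
- rewrite hornerM -polyC_natr hornerC horner_map mulf_neq0 //.
  by rewrite fmorph_eq0.
- by rewrite horner_map fmorph_eq0.
rewrite rderivD !rderiv_frac ?nzi //.
have -> : (- (d.+1%:R * map_poly iota n))^`() = - (d.+1%:R * map_poly iota n^`()).
  by rewrite derivN -polyC_natr derivM derivC mul0r add0r deriv_map.
rewrite derivN.
move: ef; rewrite !(rmorphM, rmorphB, rmorphN, rmorphXn) /= -/(map_poly iota _) !map_polyX !map_polyC /=.
rewrite -?deriv_map.
move: e => /(congr1 (@tofrac {poly U})).
rewrite !(rmorphM, rmorphD, rmorphB, rmorphN, rmorphXn) /=.
move=> e ef; rewrite -mulrA; apply: residue_identity ef e; rewrite ?tofrac_eq0 //.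
exact: nzi.
Qed.
End GenericOrAlgebraic.

(** * Partial differential isomorphisms *)

Section PartialIsomorphisms.
Variables (U : fieldType) (delta : U -> U).
Hypothesis der : is_derivation delta.

(** A partial isomorphism between two subrings of U, given by its graph: the graph is
    a subring of U x U, and the last clause makes it single-valued and injective. *)
Definition ring_piso (H : U -> U -> Prop) : Prop :=
  [/\ H 1 1,
      forall a b c d, H a b -> H c d -> H (a - c) (b - d),
      forall a b c d, H a b -> H c d -> H (a * c) (b * d) &
      forall a b, H a b -> a = 0 <-> b = 0].

Definition der_closed (H : U -> U -> Prop) : Prop :=
  forall a b, H a b -> H (delta a) (delta b).

Definition frac_rel (H : U -> U -> Prop) (a b : U) : Prop :=
  exists x y x' y', [/\ H x y, H x' y', x' != 0, a = x / x' & b = y / y'].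

Section RingPiso.
Variable H : U -> U -> Prop.
Hypothesis pH : ring_piso H.

Lemma piso1 : H 1 1. Proof. by case: pH. Qed.
Lemma pisoB a b c d : H a b -> H c d -> H (a - c) (b - d).
Proof. by case: pH => ? + *; apply. Qed.
Lemma pisoM a b c d : H a b -> H c d -> H (a * c) (b * d).
Proof. by case: pH => ? ? + *; apply. Qed.
Lemma piso_eq0 a b : H a b -> a = 0 <-> b = 0.
Proof. by case: pH => ? ? ? + *; apply. Qed.
Lemma piso0 : H 0 0. Proof. by rewrite -[0](subrr 1); apply: pisoB; apply: piso1. Qed.
Lemma pisoN a b : H a b -> H (- a) (- b).
Proof. by rewrite -[- a]add0r -[- b]add0r; apply: pisoB; apply: piso0. Qed.
Lemma pisoD a b c d : H a b -> H c d -> H (a + c) (b + d).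
Proof. by move=> ab cd; rewrite -[c]opprK -[d]opprK; apply: pisoB (pisoN cd). Qed.
Lemma piso_neq0 a b : H a b -> a != 0 -> b != 0.
Proof. by move=> ab; apply: contraNneq => b0; apply/eqP/(piso_eq0 ab). Qed.

Lemma piso_fun a b b' : H a b -> H a b' -> b = b'.
Proof.
move=> ab ab'; apply/eqP; rewrite -subr_eq0; apply/eqP.
by apply/(piso_eq0 (pisoB ab ab')); rewrite subrr.
Qed.

Lemma frac_rel_sub a b : H a b -> frac_rel H a b.
Proof. by move=> ab; exists a, b, 1, 1; rewrite oner_neq0 !divr1; split=> //; apply: piso1. Qed.

Lemma frac_rel_piso : ring_piso (frac_rel H).
Proof.
split.
- by apply: frac_rel_sub; apply: piso1.
- move=> _ _ _ _ [x [y [x' [y' [xy x'y' x'0 -> ->]]]]] [z [t [z' [t' [zt z't' z'0 -> ->]]]]].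
  have y'0 := piso_neq0 x'y' x'0; have t'0 := piso_neq0 z't' z'0.
  exists (x * z' - z * x'), (y * t' - t * y'), (x' * z'), (y' * t').
  split; first by apply: pisoB; apply: pisoM.
  + exact: pisoM.
  + exact: mulf_neq0.
  + by field; rewrite x'0 z'0.
  + by field; rewrite y'0 t'0.
- move=> _ _ _ _ [x [y [x' [y' [xy x'y' x'0 -> ->]]]]] [z [t [z' [t' [zt z't' z'0 -> ->]]]]].
  exists (x * z), (y * t), (x' * z'), (y' * t').
  by rewrite !mulf_div; split=> //; [apply: pisoM | apply: pisoM | apply: mulf_neq0].
move=> _ _ [x [y [x' [y' [xy x'y' x'0 -> ->]]]]].
have y'0 := piso_neq0 x'y' x'0.
by split=> /eqP; rewrite mulf_eq0 invr_eq0 ?(negPf x'0) ?(negPf y'0) orbF => /eqP /(piso_eq0 xy) ->;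
  rewrite mul0r.
Qed.

Lemma frac_relV a b : frac_rel H a b -> frac_rel H a^-1 b^-1.
Proof.
move=> [x [y [x' [y' [xy x'y' x'0 -> ->]]]]]; have [x0|x0] := eqVneq x 0.
  have -> : y = 0 by apply/(piso_eq0 xy).
  by rewrite x0 !mul0r invr0; apply: frac_rel_sub; apply: piso0.
by exists x', y', x, y; rewrite !invf_div.
Qed.

(** By the quotient rule it is enough to control the derivatives of the generating
    pairs, and these may already lie in the fraction field. *)
Lemma frac_rel_der_closed :
  (forall a b, H a b -> frac_rel H (delta a) (delta b)) -> der_closed (frac_rel H).
Proof.
have [_ FB FM _] := frac_rel_piso.
move=> dH _ _ [x [y [x' [y' [xy x'y' x'0 -> ->]]]]].
have y'0 := piso_neq0 x'y' x'0.
have div_der u v : v != 0 -> delta (u / v) = (delta u * v - u * delta v) * (v^-1 * v^-1).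
  by move=> v0; rewrite (derM der) (derV der) //; move: (delta u) (delta v) => du dv; field.
rewrite !div_der //; apply: (FM); last by apply: (FM); apply: frac_relV; apply: frac_rel_sub.
by apply: FB; apply: FM; [apply: dH | apply: frac_rel_sub | apply: frac_rel_sub | apply: dH].
Qed.
End RingPiso.

End PartialIsomorphisms.

Section CoefficientField.
Variables (U : fieldType) (H : U -> U -> Prop).
Hypothesis pH : ring_piso H.

Definition piso_dom : {pred U} := fun a => `[< exists b, frac_rel H a b >].

Lemma piso_dom_divring : divring_closed piso_dom.
Proof.
have [F1 FB FM _] := frac_rel_piso pH.
split; first by apply/asboolP; exists 1.
- by move=> a c /asboolP [b ab] /asboolP [d cd]; apply/asboolP; exists (b - d); apply: FB.
- move=> a c /asboolP [b ab] /asboolP [d cd]; apply/asboolP; exists (b / d).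
  by apply: FM => //; apply: frac_relV.
Qed.

HB.instance Definition _ := GRing.isDivringClosed.Build U piso_dom piso_dom_divring.

(** The proof that H is a partial isomorphism is an argument so that the field
    structure can be attached to the type. *)
Definition piso_field_of (_ : ring_piso H) := {a : U | a \in piso_dom}.
Local Notation piso_field := (piso_field_of pH).
HB.instance Definition _ := [isSub of piso_field for @sval U (fun a => a \in piso_dom)].
HB.instance Definition _ := [Choice of piso_field by <:].
HB.instance Definition _ := [SubChoice_isSubIntegralDomain of piso_field by <:].
HB.instance Definition _ := [SubIntegralDomain_isSubField of piso_field by <:].

Lemma piso_imageP (a : piso_field) : exists b, frac_rel H (val a) b.
Proof. by case: a => a /= /asboolP. Qed.

Definition piso_image (a : piso_field) : U := projT1 (cid (piso_imageP a)).

Lemma piso_image_rel a : frac_rel H (val a) (piso_image a).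
Proof. by rewrite /piso_image; case: cid. Qed.

Lemma piso_image_zmod : zmod_morphism piso_image.
Proof.
have [_ FB _ _] := frac_rel_piso pH; move=> a b.
apply: (piso_fun (frac_rel_piso pH) (piso_image_rel _)).
by rewrite rmorphB; apply: FB; apply: piso_image_rel.
Qed.

Lemma piso_image_monoid : monoid_morphism piso_image.
Proof.
have [F1 _ FM _] := frac_rel_piso pH; split=> [|a b];
  apply: (piso_fun (frac_rel_piso pH) (piso_image_rel _)).
  by rewrite rmorph1.
by rewrite rmorphM; apply: FM; apply: piso_image_rel.
Qed.

HB.instance Definition _ := GRing.isZmodMorphism.Build piso_field U piso_image piso_image_zmod.
HB.instance Definition _ := GRing.isMonoidMorphism.Build piso_field U piso_image piso_image_monoid.

End CoefficientField.

(** Replaces a partial isomorphism by an abstract differential field k with two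
    embeddings in U, so that polynomials over k can be evaluated on both sides. *)
Lemma coefficient_field (U : fieldType) (delta : U -> U) (H : U -> U -> Prop) :
  is_derivation delta -> ring_piso H -> der_closed delta H ->
  exists (k : fieldType) (i1 i2 : {rmorphism k -> U}) (D : k -> k),
  [/\ forall c, i1 (D c) = delta (i1 c), forall c, i2 (D c) = delta (i2 c),
      forall a b, H a b -> exists2 c, i1 c = a & i2 c = b &
      forall c, frac_rel H (i1 c) (i2 c)].
Proof.
move=> der pH dH; have pF := frac_rel_piso pH.
have F_fun := piso_fun pF.
pose i1 : {rmorphism piso_field_of pH -> U} := val.
pose i2 : {rmorphism piso_field_of pH -> U} := @piso_image U H pH.
have i12 c : frac_rel H (i1 c) (i2 c) by apply: piso_image_rel.
have dF : der_closed delta (frac_rel H).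
  by apply: frac_rel_der_closed => // a b /dH; apply: frac_rel_sub.
have lift a b : frac_rel H a b -> exists2 c, i1 c = a & i2 c = b.
  move=> ab; have a_dom : a \in piso_dom H by apply/asboolP; exists b.
  exists (exist _ a a_dom) => //; apply: F_fun (i12 _) _; exact: ab.
have dlift c : exists c', i1 c' = delta (i1 c) /\ i2 c' = delta (i2 c).
  by have [c' e1 e2] := lift _ _ (dF _ _ (i12 c)); exists c'.
exists (piso_field_of pH), i1, i2, (fun c => projT1 (cid (dlift c))).
split=> //; [by move=> c; case: cid => ? [] | by move=> c; case: cid => ? [] |].
by move=> a b ab; apply: lift; apply: frac_rel_sub.
Qed.

(** * Differential polynomials in one further variable *)

Section MultivariateAsUnivariate.

(** Induction along the generation of the polynomial ring by constants and variables,
    used to compare ring morphisms and to propagate closure properties. *)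
Lemma mpoly_gen_ind n (R : nzRingType) (Q : {mpoly R[n]} -> Prop) :
  (forall c, Q c%:MP) -> (forall i, Q 'X_i) ->
  (forall p q, Q p -> Q q -> Q (p + q)) -> (forall p q, Q p -> Q q -> Q (p * q)) ->
  forall p, Q p.
Proof.
move=> QC QX QD QM; have Q1 : Q 1 by exact: (QC 1).
move=> p; elim/mpolyind: p => [|c m p _ _ Qp]; first exact: (QC 0).
apply: QD Qp; rewrite -mul_mpolyC; apply: (QM _ _ (QC c)).
rewrite mpolyXE_id; apply: (big_ind Q Q1 QM) => i _.
by elim: (m i) => [|d IH]; rewrite ?expr0 // exprS; apply: QM.
Qed.

Local Notation widen := (widen_ord (leqnSn _)).

Lemma mmap_mwiden n (R : comNzRingType) (S : comNzRingType) (f : {rmorphism R -> S})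
    (h : 'I_n.+1 -> S) (p : {mpoly R[n]}) :
  mmap f h (mwiden p) = mmap f (fun i => h (widen i)) p.
Proof.
elim/mpoly_gen_ind: p => [c|i|p q IHp IHq|p q IHp IHq].
- by rewrite mwidenC !mmapC.
- by rewrite mwidenX mnmwiden1 !mmapX !mmap1U.
- by rewrite mwidenD !mmapD IHp IHq.
- by rewrite mwidenM !rmorphM /= IHp IHq.
Qed.

Lemma mmap_mmulti n (R : comNzRingType) (S : comNzRingType) (f : {rmorphism R -> S})
    (h : 'I_n.+1 -> S) (p : {poly {mpoly R[n]}}) :
  mmap f h (mmulti p) = (map_poly (mmap f (fun i => h (widen i))) p).[h ord_max].
Proof.
rewrite /mmulti rmorph_sum /= [in RHS]/map_poly horner_poly.
apply: eq_bigr => i _.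
by rewrite rmorphM rmorphXn /= mmap_mwiden mmapX mmap1U.
Qed.

Lemma muni_mwiden n (R : comNzRingType) (q : {mpoly R[n]}) : muni (mwiden q) = q%:P.
Proof.
elim/mpoly_gen_ind: q => [c|i|p q IHp IHq|p q IHp IHq].
- by rewrite mwidenC muniC.
- rewrite mwidenX mnmwiden1 muniE msuppX big_seq1 mcoeffX eqxx scale1r.
  rewrite mnm1E -val_eqE /= ltn_eqF ?ltn_ord // expr0 alg_polyC; congr (_%:P).
  by congr 'X_[_]; apply/mnmP => j; rewrite mnmE !mnm1E -!val_eqE.
- by rewrite mwidenD muniD IHp IHq polyCD.
- by rewrite mwidenM muniM IHp IHq polyCM.
Qed.

Lemma muni_X n (R : comNzRingType) : muni ('X_ord_max : {mpoly R[n.+1]}) = 'X.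
Proof.
rewrite muniE msuppX big_seq1 mcoeffX eqxx scale1r mnm1E eqxx expr1.
rewrite [X in 'X_[X]](_ : _ = 0%MM); first by rewrite mpolyX0 scale1r.
by apply/mnmP => j; rewrite mnmE mnm1E mnm0E -val_eqE /= eq_sym ltn_eqF.
Qed.

Lemma muni_mmulti n (R : comNzRingType) (p : {poly {mpoly R[n]}}) : muni (mmulti p) = p.
Proof.
rewrite [RHS](_ : p = \sum_(i < size p) (p`_i)%:P * 'X ^+ i); last first.
  by rewrite -{1}[p]coefK poly_def; apply: eq_bigr => i _; rewrite mul_polyC.
rewrite /mmulti raddf_sum /=; apply: eq_bigr => i _.
by rewrite muniM rmorphXn /= muni_X muni_mwiden.
Qed.

Lemma mmap_muni n (R : comNzRingType) (S : comNzRingType) (f : {rmorphism R -> S})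
    (h : 'I_n.+1 -> S) (P : {mpoly R[n.+1]}) :
  mmap f h P = (map_poly (mmap f (fun i => h (widen i))) (muni P)).[h ord_max].
Proof.
elim/mpoly_gen_ind: P => [c|i|p q IHp IHq|p q IHp IHq].
- by rewrite muniC mmapC map_polyC /= mmapC hornerC.
- rewrite mmapX mmap1U; have [->|ne] := eqVneq i ord_max.
    by rewrite muni_X map_polyX hornerX.
  have lt : (i < n)%N.
    by have := ltn_ord i; rewrite ltnS leq_eqVlt; move: ne; rewrite -val_eqE /= => /negPf ->.
  have -> : i = widen (Ordinal lt) by apply: val_inj.
  by rewrite -mnmwiden1 -mwidenX muni_mwiden map_polyC hornerC /= mmapX mmap1U.
- by rewrite muniD mmapD rmorphD hornerD IHp IHq.
- by rewrite muniM !rmorphM hornerM /= IHp IHq.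
Qed.

Lemma mmultiE n (R : comNzRingType) (p : {poly {mpoly R[n]}}) :
  mmulti p = (map_poly (@mwiden n R) p).['X_ord_max].
Proof. by rewrite [in RHS]/map_poly horner_poly. Qed.

Lemma muniK n (R : comNzRingType) : cancel (@muni n R) (@mmulti n R).
Proof.
move=> P; rewrite mmultiE; elim/mpoly_gen_ind: P => [c|i|p q IHp IHq|p q IHp IHq].
- by rewrite muniC map_polyC hornerC /= mwidenC.
- have [->|ne] := eqVneq i ord_max; first by rewrite muni_X map_polyX hornerX.
  have lt : (i < n)%N.
    by have := ltn_ord i; rewrite ltnS leq_eqVlt; move: ne; rewrite -val_eqE /= => /negPf ->.
  have -> : i = widen (Ordinal lt) by apply: val_inj.
  by rewrite -mnmwiden1 -mwidenX muni_mwiden map_polyC hornerC.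
- rewrite muniD; move: (muni p) (muni q) IHp IHq => a b IHp IHq.
  by rewrite rmorphD hornerD /= IHp IHq.
- rewrite muniM; move: (muni p) (muni q) IHp IHq => a b IHp IHq.
  by rewrite rmorphM hornerM /= IHp IHq.
Qed.

Lemma muni_eq0 n (R : comNzRingType) (P : {mpoly R[n.+1]}) : (muni P == 0) = (P == 0).
Proof.
apply/eqP/eqP => [e|->]; last exact: muni0.
by apply: (can_inj (@muniK n R)); rewrite e muni0.
Qed.

Variables (U : fieldType) (delta : U -> U).
Hypothesis blum : blum_axioms delta.

(** Blum's axiom for an equation seen as a polynomial in the highest derivative: such
    a polynomial of positive degree has exact order n. *)
Lemma blum_univariate n (p : {poly {mpoly U[n]}}) (g : {mpoly U[n]}) :
  (1 < size p)%N -> g != 0 ->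
  exists x : U, (map_poly (meval (jet delta x)) p).[iter n delta x] = 0 /\
    g.@[jet delta x] != 0.
Proof.
move=> sp g0.
have occ : exists2 m, m \in msupp (mmulti p) & m ord_max != 0%N.
  apply: contrapT => no; move: sp; rewrite -{1}[p]muni_mmulti muniE ltnNge => /negP; apply.
  rewrite big_seq; apply: (big_ind (fun q : {poly {mpoly U[n]}} => (size q <= 1)%N)).
  - by rewrite size_poly0.
  - by move=> a b sa sb; apply: leq_trans (size_polyD a b) _; rewrite geq_max sa.
  move=> m min; have [->|m0] := eqVneq (m ord_max) 0%N; last by case: no; exists m.
  by rewrite expr0; apply: leq_trans (size_scale_leq _ _) _; rewrite size_poly1.
have [x [ex gx]] := blum occ g0.
exists x; split=> //; by rewrite -[RHS]ex /meval mmap_mmulti.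
Qed.
End MultivariateAsUnivariate.

Section BivariateJets.
Variables (k U : fieldType) (j : {rmorphism k -> U}) (delta : U -> U).

(* A polynomial in zero variables is a constant. *)
Let e0 : {mpoly k[0]} -> k := mmap (idfun : {rmorphism k -> k}) (fun _ => 0).

Let e0K : cancel e0 (@mpolyC 0 k).
Proof.
elim/mpoly_gen_ind => [c|[]//|p q IHp IHq|p q IHp IHq].
- by rewrite /e0 mmapC.
- by rewrite /e0 mmapD -/e0 mpolyCD IHp IHq.
- by rewrite /e0 rmorphM /= -/e0 mpolyCM IHp IHq.
Qed.

Let e0_eq0 p : e0 p = 0 -> p = 0.
Proof. by move=> e; rewrite -[p]e0K e mpolyC0. Qed.

Let e0_eval (h : 'I_0 -> U) p : mmap j h p = j (e0 p).
Proof. by rewrite -{1}[p]e0K mmapC. Qed.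

Let poly_of (p : {mpoly k[1]}) : {poly k} := map_poly e0 (muni p).

Let poly_of_eq0 p : poly_of p = 0 -> p = 0.
Proof.
move=> e; apply/eqP; rewrite -muni_eq0; apply/eqP/polyP => i.
rewrite coef0; apply: e0_eq0.
by rewrite -[RHS](coef0 k i) -e /poly_of coef_map.
Qed.

Let poly_of_eval z p : mmap j (jet delta z) p = (map_poly j (poly_of p)).[z].
Proof.
rewrite mmap_muni; congr (_.[_]); apply/polyP => i.
by rewrite !coef_map /= e0_eval.
Qed.

(** A relation between z and z' over k is an equation for z' over k[z]. *)
Lemma mpoly2_poly (P : {mpoly k[2]}) : P != 0 -> exists2 Q : {poly {poly k}}, Q != 0 &
  forall z, mmap j (jet delta z) P = (map_poly (eval_at j z) Q).[delta z].
Proof.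
move=> P0; have po0 : poly_of 0 = 0 by rewrite /poly_of muni0 map_poly0.
exists (map_poly poly_of (muni P)) => [|z].
  apply: contraNneq P0 => e; rewrite -muni_eq0; apply/eqP/polyP => i.
  rewrite coef0; apply: poly_of_eq0.
  by rewrite -[RHS](coef0 {poly k} i) -e coef_map_id0.
rewrite mmap_muni; congr (_.[_]); apply/polyP => i.
rewrite !coef_map /= coef_map_id0 // /eval_at -poly_of_eval.
by [].
Qed.
End BivariateJets.

(** * Realizing types by saturation *)

Section Saturation.
Variables (U : fieldType) (delta : U -> U).
Hypothesis charU : [pchar U] =i pred0.
Hypothesis sat : saturated delta.

Lemma char0_infinite : infinite_set [set: U].
Proof.
move=> fU; apply: infinite_nat.
apply: (@sub_finite_set _ _ ((fun n : nat => n%:R : U) @^-1` setT)) => //.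
apply: finite_preimage fU => m n _ _ /= e.
wlog le : m n e / (m <= n)%N => [H|].
  by have [le|/ltnW le] := leqP m n; [|apply/esym]; apply: H.
apply/eqP; rewrite eqn_leq le /= -subn_eq0.
by move/pcharf0P: charU => <-; rewrite natrB // e subrr.
Qed.

(** Functions of one variable expressible by terms over B up to division. Division is
    needed because the coefficient fields consist of quotients of values of terms. *)
Definition term_ratio (B : set U) (F : U -> U) : Prop :=
  exists t s : term U 1, [/\ tparams t `<=` B, tparams s `<=` B &
    forall v, teval delta [tuple v] s != 0 /\
      F v = teval delta [tuple v] t / teval delta [tuple v] s].

Lemma term_ratioD B F G : term_ratio B F -> term_ratio B G -> term_ratio B (fun v => F v + G v).
Proof.
move=> [t [s [tB sB e]]] [t' [s' [t'B s'B e']]].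
exists (Add (Mul t s') (Mul t' s)), (Mul s s'); split=> [||v] /=; rewrite ?subUset //.
by have [s0 ->] := e v; have [s'0 ->] := e' v; rewrite mulf_neq0 // addf_div.
Qed.

Lemma term_ratioM B F G : term_ratio B F -> term_ratio B G -> term_ratio B (fun v => F v * G v).
Proof.
move=> [t [s [tB sB e]]] [t' [s' [t'B s'B e']]].
exists (Mul t t'), (Mul s s'); split=> [||v] /=; rewrite ?subUset //.
by have [s0 ->] := e v; have [s'0 ->] := e' v; rewrite mulf_neq0 // mulf_div.
Qed.

Lemma term_ratio_iter B i : term_ratio B (fun v => iter i delta v).
Proof.
exists (iter i (@Der U 1) (Var U ord0)), (One U 1).
have tE v : teval delta [tuple v] (iter i (@Der U 1) (Var U ord0)) = iter i delta v.
  by elim: i => //= i ->.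
split=> [||v] /=; [by elim: i {tE} => //= ? ? | by [] |].
by rewrite oner_neq0 divr1 tE.
Qed.

Section Polynomials.
Variables (k : fieldType) (j : {rmorphism k -> U}) (B : set U).
Hypothesis kB : forall c, term_ratio B (fun _ => j c).

Lemma term_ratio_mpoly n (P : {mpoly k[n]}) : term_ratio B (fun v => mmap j (jet delta v) P).
Proof.
elim/mpoly_gen_ind: P => [c|i|p q IHp IHq|p q IHp IHq].
- by have [t [s [tB sB e]]] := kB c; exists t, s; split=> // v; rewrite mmapC.
- have [t [s [tB sB e]]] := term_ratio_iter B i.
  by exists t, s; split=> // v; rewrite mmapX mmap1U.
- have [t [s [tB sB e]]] := term_ratioD IHp IHq.
  by exists t, s; split=> // v; rewrite mmapD.
- have [t [s [tB sB e]]] := term_ratioM IHp IHq.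
  by exists t, s; split=> // v; rewrite rmorphM.
Qed.
End Polynomials.

(** The type made of phi and of the inequations F <> 0 for F in N. Since N is closed
    under products, finitely many inequations amount to a single one. *)
Lemma saturation_avoid (B : set U) (phi : formula U 1) (N : set (U -> U)) :
  finite_set B -> fparams phi `<=` B ->
  (forall F, N F -> term_ratio B F) ->
  N (fun _ => 1) -> (forall F G, N F -> N G -> N (fun v => F v * G v)) ->
  (forall F, N F -> exists v, holds delta phi [tuple v] /\ F v != 0) ->
  exists v, holds delta phi [tuple v] /\ forall F, N F -> F v != 0.
Proof.
move=> finB phiB NB N1 NM Nex.
pose p : set (formula U 1) := [set chi | chi = phi \/ exists F t, [/\ N F,
  tparams t `<=` B, chi = Not (Eq t (Zero U 1)) &
  forall v, F v != 0 <-> teval delta [tuple v] t != 0]].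
have pB chi : p chi -> fparams chi `<=` B.
  by case=> [->//|[F [t [_ tB -> _]]]] /=; rewrite setU0.
have cB : ~~ ([set: U] #<= B)%card.
  by apply/negP => /card_le_finite /(_ finB); apply: char0_infinite.
have pfin (q : set (formula U 1)) : finite_set q -> q `<=` p ->
    exists x, forall chi, q chi -> holds delta chi x.
  move=> [n]; rewrite card_eq_le => /andP [/pcard_leP /injfunPex [g gn gI] _] qp.
  have : exists2 F, N F & forall v, F v != 0 -> holds delta phi [tuple v] ->
      forall chi, q chi -> (g chi < n)%N -> holds delta chi [tuple v].
    elim: n {gn} => [|n [F NF HF]]; first by exists (fun _ => 1).
    have [[psi [qpsi gpsi]]|no] := pselect (exists psi, q psi /\ g psi = n); last first.
      exists F => // v Fv hv chi qchi; rewrite ltnS leq_eqVlt => /orP [/eqP e|]; last exact: HF.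
      by case: no; exists chi.
    have [G NG HG] : exists2 G, N G & forall v, G v != 0 -> holds delta phi [tuple v] ->
        holds delta psi [tuple v].
      case: (qp _ qpsi) => [->|[G [t [NG _ -> Gt]]]]; first by exists (fun _ => 1).
      by exists G => // v /Gt t0 _ /=; apply/eqP.
    exists (fun v => F v * G v); first exact: NM.
    move=> v; rewrite mulf_eq0 negb_or => /andP [Fv Gv] hv chi qchi.
    rewrite ltnS leq_eqVlt => /orP [/eqP e|lt]; last exact: HF.
    by rewrite (gI chi psi) ?gpsi ?inE //; apply: HG.
  case=> F NF HF; have [v [hv Fv]] := Nex F NF.
  by exists [tuple v] => chi qchi; apply: HF => //; apply: gn.
have [x Hx] := sat cB pB pfin.
have xE : x = [tuple tnth x ord0].
  by apply: eq_from_tnth => i; rewrite !ord1.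
exists (tnth x ord0); rewrite -xE; split=> [|F NF]; first by apply: Hx; left.
have [t [s [tB sB e]]] := NB F NF.
have Ft v : F v != 0 <-> teval delta [tuple v] t != 0.
  by have [s0 ->] := e v; rewrite mulf_eq0 invr_eq0 (negPf s0) orbF.
apply/Ft; rewrite -xE; apply/eqP; apply: (Hx (Not (Eq t (Zero U 1)))).
by right; exists F, t.
Qed.
End Saturation.

(** * Extending a partial isomorphism *)

(** A polynomial p of least degree among those that vanish at w, if it vanishes at v,
    is also of least degree at v: a polynomial r of least degree at v divides p up to
    a constant, and by minimality of p at w the quotient is constant. Hence the roots
    w and v of p satisfy the same polynomials. *)
Lemma minimal_common_roots (L : idomainType) (U : fieldType) (j1 j2 : {rmorphism L -> U})
    (w v : U) (p : {poly L}) :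
  (forall c, c != 0 -> j1 c != 0) -> (forall c, c != 0 -> j2 c != 0) ->
  p != 0 -> (map_poly j1 p).[w] = 0 -> (map_poly j2 p).[v] = 0 ->
  (forall q, q != 0 -> (map_poly j1 q).[w] = 0 -> (size p <= size q)%N) ->
  forall q, (map_poly j1 q).[w] = 0 <-> (map_poly j2 q).[v] = 0.
Proof.
move=> nz1 nz2 p0 pw pv minp.
(* pseudo-division by a minimal annihilator leaves no remainder *)
have dvd (j : {rmorphism L -> U}) x (r q : {poly L}) : (map_poly j r).[x] = 0 -> r != 0 ->
    (forall q, q != 0 -> (map_poly j q).[x] = 0 -> (size r <= size q)%N) ->
    (map_poly j q).[x] = 0 -> exists c s, c != 0 /\ c *: q = s * r.
  move=> rx r0 minr qx; exists (lead_coef r ^+ scalp q r), (q %/ r).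
  split; first by rewrite expf_neq0 // lead_coef_eq0.
  have e := Pdiv.Idomain.divp_eq q r.
  suff m0 : q %% r = 0 by rewrite e m0 addr0.
  apply/eqP; apply: contraT => m0; have := ltn_modp q r; rewrite r0 ltnNge minr //.
  have -> : q %% r = lead_coef r ^+ scalp q r *: q - q %/ r * r by rewrite e addrC addKr.
  by rewrite rmorphB /= map_polyZ rmorphM /= !hornerE qx rx !mulr0 subrr.
have transfer (j j' : {rmorphism L -> U}) x x' r q : (forall c, c != 0 -> j' c != 0) ->
    (map_poly j r).[x] = 0 -> (map_poly j' r).[x'] = 0 -> r != 0 ->
    (forall q, q != 0 -> (map_poly j q).[x] = 0 -> (size r <= size q)%N) ->
    (map_poly j q).[x] = 0 -> (map_poly j' q).[x'] = 0.
  move=> nz rx rx' r0 minr qx; have [c [s [c0 e]]] := dvd j x r q rx r0 minr qx.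
  have := congr1 (fun q => (map_poly j' q).[x']) e.
  rewrite map_polyZ rmorphM /= !hornerE rx' mulr0 => /eqP.
  by rewrite mulf_eq0 (negPf (nz _ c0)) => /eqP.
have [r [r0 rv] minr] := @ex_minimizer _ (fun q : {poly L} => size q)
  (fun q => q != 0 /\ (map_poly j2 q).[v] = 0) (ex_intro _ p (conj p0 pv)).
have {}minr q : q != 0 -> (map_poly j2 q).[v] = 0 -> (size r <= size q)%N by move=> *; apply: minr.
suff minp2 q : q != 0 -> (map_poly j2 q).[v] = 0 -> (size p <= size q)%N.
  by move=> q; split; [apply: (transfer j1 j2 w v p) | apply: (transfer j2 j1 v w p)].
move=> q0 qv; apply: leq_trans (minr q q0 qv).
have [c [s [c0 e]]] := dvd j2 v r p rv r0 minr pv.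
have s0 : s != 0.
  by apply: contraNneq p0 => s0; move/eqP: e; rewrite s0 mul0r scale_poly_eq0 (negPf c0).
have := congr1 (fun q => (map_poly j1 q).[w]) e.
rewrite map_polyZ rmorphM /= !hornerE pw mulr0 => /esym /eqP.
rewrite mulf_eq0 => /orP [] /eqP sw; last exact: minp.
have := minp s s0 sw; rewrite -(size_scale p c0) e size_mul //.
have r_gt0 : (0 < size r)%N by rewrite size_poly_gt0.
have s_gt0 : (0 < size s)%N by rewrite size_poly_gt0.
move=> le; have r1 : (size r <= 1)%N.
  by rewrite -(leq_add2l (size s)) addn1 -(prednK (n := _ + _)) ?ltnS // addn_gt0 s_gt0.
move: rv; rewrite (size1_polyC r1) map_polyC hornerC => /eqP.
suff /nz2/negPf -> : r`_0 != 0 by [].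
by apply: contraNneq r0 => r00; rewrite (size1_polyC r1) r00.
Qed.

Section JetRelation.
Variables (U : fieldType) (delta : U -> U).
Hypothesis der : is_derivation delta.
Hypothesis charU : [pchar U] =i pred0.
Variables (k : fieldType) (i1 i2 : {rmorphism k -> U}) (D : k -> k).
Hypothesis i1D : forall c, i1 (D c) = delta (i1 c).
Hypothesis i2D : forall c, i2 (D c) = delta (i2 c).

Definition independent_jet (j : {rmorphism k -> U}) n w : Prop :=
  forall P : {mpoly k[n]}, P != 0 -> mmap j (jet delta w) P != 0.

Section Pair.
Variables w v : U.

Definition jet_rel n (a b : U) : Prop :=
  exists P : {mpoly k[n]}, a = mmap i1 (jet delta w) P /\ b = mmap i2 (jet delta v) P.

Lemma jet_relD n a b c d : jet_rel n a b -> jet_rel n c d -> jet_rel n (a + c) (b + d).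
Proof. by move=> [P [-> ->]] [Q [-> ->]]; exists (P + Q); rewrite !mmapD. Qed.

Lemma jet_relM n a b c d : jet_rel n a b -> jet_rel n c d -> jet_rel n (a * c) (b * d).
Proof. by move=> [P [-> ->]] [Q [-> ->]]; exists (P * Q); rewrite !rmorphM. Qed.

Lemma jet_relC n c : jet_rel n (i1 c) (i2 c).
Proof. by exists c%:MP; rewrite !mmapC. Qed.

Lemma jet_rel_iter n i : (i < n)%N -> jet_rel n (iter i delta w) (iter i delta v).
Proof. by move=> lt; exists 'X_(Ordinal lt); rewrite !mmapX !mmap1U. Qed.

Lemma jet_relS n a b : jet_rel n a b -> jet_rel n.+1 a b.
Proof. by move=> [P [-> ->]]; exists (mwiden P); rewrite !mmap_mwiden. Qed.

Lemma jet_rel_mono n m a b : (n <= m)%N -> jet_rel n a b -> jet_rel m a b.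
Proof.
move=> /subnK <-; elim: (m - n)%N => [//|d IH] H.
by rewrite addSn; apply: jet_relS; apply: IH.
Qed.

Lemma jet_rel_der n a b : jet_rel n a b -> jet_rel n.+1 (delta a) (delta b).
Proof.
move=> [P [-> ->]]; elim/mpoly_gen_ind: P => [c|i|p q IHp IHq|p q IHp IHq].
- by rewrite !mmapC -i1D -i2D; apply: jet_relC.
- by rewrite !mmapX !mmap1U; apply: (@jet_rel_iter n.+1 i.+1); apply: ltn_ord.
- by rewrite !mmapD !(derD der); apply: jet_relD.
- have rel (r : {mpoly k[n]}) : jet_rel n.+1 (mmap i1 (jet delta w) r) (mmap i2 (jet delta v) r).
    by apply: jet_relS; exists r.
  by rewrite !rmorphM !(derM der); apply: jet_relD; apply: jet_relM => //; apply: rel.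
Qed.

Lemma jet_rel_piso n :
  (forall P : {mpoly k[n]}, mmap i1 (jet delta w) P = 0 <-> mmap i2 (jet delta v) P = 0) ->
  ring_piso (jet_rel n).
Proof.
move=> eq0; split.
- by have := jet_relC n 1; rewrite !rmorph1.
- by move=> a b c d [P [-> ->]] [Q [-> ->]]; exists (P - Q); rewrite !mmapB.
- by move=> a b c d; apply: jet_relM.
- by move=> a b [P [-> ->]].
Qed.

Lemma independent_jets_eq0 n (P : {mpoly k[n]}) :
  independent_jet i1 n w -> independent_jet i2 n v ->
  mmap i1 (jet delta w) P = 0 <-> mmap i2 (jet delta v) P = 0.
Proof.
move=> indw indv; have [->|P0] := eqVneq P 0; first by rewrite !mmap0.
by split=> /eqP; [rewrite (negPf (indw P P0)) | rewrite (negPf (indv P P0))].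
Qed.

Definition extends (H : U -> U -> Prop) : Prop :=
  [/\ ring_piso H, der_closed delta H, forall c, H (i1 c) (i2 c) & H w v].

(** Without any differential relation, evaluation of differential polynomials is
    injective on both sides. *)
Lemma transcendental_extension :
  (forall n, independent_jet i1 n w) -> (forall n, independent_jet i2 n v) ->
  exists H, extends H.
Proof.
move=> indw indv; exists (fun a b => exists n, jet_rel n a b).
have pn n := jet_rel_piso (fun P => @independent_jets_eq0 n P (indw n) (indv n)).
have common (a b c d : U) : (exists n, jet_rel n a b) -> (exists n, jet_rel n c d) ->
    exists n, jet_rel n a b /\ jet_rel n c d.
  move=> [n ab] [m cd]; exists (maxn n m).
  by split; [apply: jet_rel_mono ab | apply: jet_rel_mono cd]; rewrite ?leq_maxl ?leq_maxr.
split; [split| | |].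
- by exists 0%N; apply: (piso1 (pn 0%N)).
- by move=> a b c d ab cd; have [n [? ?]] := common _ _ _ _ ab cd; exists n; apply: (pisoB (pn n)).
- by move=> a b c d ab cd; have [n [? ?]] := common _ _ _ _ ab cd; exists n; apply: (pisoM (pn n)).
- by move=> a b [n ab]; apply: (piso_eq0 (pn n) ab).
- by move=> a b [n ab]; exists n.+1; apply: jet_rel_der.
- by move=> c; exists 0%N; apply: jet_relC.
- by exists 1%N; apply: (@jet_rel_iter 1 0).
Qed.

Section Algebraic.
Variables (n : nat) (p : {poly {mpoly k[n]}}).
Hypothesis indw : independent_jet i1 n w.
Hypothesis indv : independent_jet i2 n v.
Local Notation j1 := (mmap i1 (jet delta w)).
Local Notation j2 := (mmap i2 (jet delta v)).
Hypothesis p0 : p != 0.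
Hypothesis pw : (map_poly j1 p).[iter n delta w] = 0.
Hypothesis pv : (map_poly j2 p).[iter n delta v] = 0.
Hypothesis minp : forall q : {poly {mpoly k[n]}},
  q != 0 -> (map_poly j1 q).[iter n delta w] = 0 -> (size p <= size q)%N.

Let H := frac_rel (jet_rel n.+1).

Let pS : ring_piso (jet_rel n.+1).
Proof.
apply: jet_rel_piso => P; rewrite !mmap_muni.
exact: (@minimal_common_roots _ _ j1 j2 _ _ p indw indv p0 pw pv minp).
Qed.

Let jet_rel_poly (q : {poly {mpoly k[n]}}) :
  jet_rel n.+1 (map_poly j1 q).[iter n delta w] (map_poly j2 q).[iter n delta v].
Proof. by exists (mmulti q); rewrite !mmap_mmulti. Qed.

(* Differentiating p(x) = 0 gives x' = - p^delta(x) / p'(x), and p' does not vanish at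
   x since p is minimal. *)
Let top_der : H (iter n.+1 delta w) (iter n.+1 delta v).
Proof.
have dp0 : p^`() != 0.
  case sp : (size p) => [|[|d]].
  - by move/eqP: sp; rewrite size_poly_eq0 (negPf p0).
  - have eC : p = (p`_0)%:P by apply: size1_polyC; rewrite sp.
    move: p0 pw; rewrite eC map_polyC hornerC polyC_eq0 => /indw /negPf n0 /eqP.
    by rewrite /= n0.
  apply/eqP => /(congr1 (fun q : {poly {mpoly k[n]}} => q`_d)) /eqP.
  rewrite coef0 coef_deriv -[d.+1]/(d.+2.-1) -sp -lead_coefE.
  move: p0; rewrite -lead_coef_eq0 => /indw l0 /eqP /(congr1 j1) /eqP.
  rewrite mmapMn mmap0 -mulr_natr mulf_eq0 (negPf l0) sp /=.
  by move/pcharf0P: charU => ->.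
have dpw : (map_poly j1 p^`()).[iter n delta w] != 0.
  by apply/negP => /eqP /(minp dp0); rewrite leqNgt lt_size_deriv.
have coefs : jet_rel n.+1 (map_poly delta (map_poly j1 p)).[iter n delta w]
                 (map_poly delta (map_poly j2 p)).[iter n delta v].
  have coefE (j : {rmorphism {mpoly k[n]} -> U}) x :
      (map_poly delta (map_poly j p)).[x] = \sum_(i < size p) delta (j p`_i) * x ^+ i.
    rewrite (@horner_coef_wide _ (size p)); last first.
      by apply: leq_trans (size_poly _ _) (size_poly _ _).
    by apply: eq_bigr => i _; rewrite coef_map_der // coef_map.
  rewrite !coefE; apply: (big_ind2 (jet_rel n.+1)); first exact: piso0.
    by move=> *; apply: jet_relD.
  move=> i _; apply: jet_relM; first by apply: jet_rel_der; exists p`_i.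
  by exists (mmulti ('X ^+ i)); rewrite !mmap_mmulti !map_polyXn !hornerXn.
have eq_top (j : {rmorphism {mpoly k[n]} -> U}) x : (map_poly j p).[x] = 0 ->
    (map_poly j p^`()).[x] != 0 ->
    delta x = - (map_poly delta (map_poly j p)).[x] / (map_poly j p^`()).[x].
  move=> px dpx; have := der_horner der (map_poly j p) x.
  rewrite px (der0 der) deriv_map => /esym /eqP; rewrite addr_eq0 => /eqP ->.
  by rewrite opprK mulrC mulKf.
have dpv := piso_neq0 pS (jet_rel_poly p^`()) dpw.
rewrite /= (eq_top j1 _ pw dpw) (eq_top j2 _ pv dpv).
exists (- (map_poly delta (map_poly j1 p)).[iter n delta w]), (- (map_poly delta (map_poly j2 p)).[iter n delta v]).
by do 2 eexists; split; [apply: pisoN coefs | apply: jet_rel_poly | exact: dpw | |].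
Qed.

(** When p is a minimal relation for the n-th derivative, the pairs of values of
    polynomials in the jets of order n already form a partial isomorphism, and the
    derivative of order n + 1 is rational in them, so that the fraction field is
    closed under delta. *)
Lemma algebraic_extension : exists H, extends H.
Proof.
have pH := frac_rel_piso pS; have sub := frac_rel_sub pS.
exists H; split.
- exact: pH.
- apply: frac_rel_der_closed => // a b [P [-> ->]].
  elim/mpoly_gen_ind: P => [c|i|q r IHq IHr|q r IHq IHr].
  + by rewrite !mmapC -i1D -i2D; apply: sub; apply: jet_relC.
  + rewrite !mmapX !mmap1U /jet -[delta _]/(iter i.+1 delta w) -[delta (iter _ _ v)]/(iter i.+1 delta v).
    have := ltn_ord i; rewrite ltnS leq_eqVlt => /orP [/eqP ->|lt]; first exact: top_der.
    by apply: sub; apply: jet_rel_iter.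
  + by rewrite !mmapD !(derD der); apply: (pisoD pH).
  + have rel (s : {mpoly k[n.+1]}) : H (mmap i1 (jet delta w) s) (mmap i2 (jet delta v) s).
      by apply: sub; exists s.
    by rewrite !rmorphM !(derM der); apply: (pisoD pH); apply: (pisoM pH) => //; apply: rel.
- by move=> c; apply: sub; apply: jet_relC.
- by apply: sub; apply: (@jet_rel_iter n.+1 0).
Qed.
End Algebraic.
End Pair.
End JetRelation.

Section Extension.
Variables (U : fieldType) (delta : U -> U).
Hypothesis der : is_derivation delta.
Hypothesis charU : [pchar U] =i pred0.
Hypothesis blum : blum_axioms delta.
Hypothesis sat : saturated delta.

Section OneStep.
Variables (k : fieldType) (i1 i2 : {rmorphism k -> U}) (D : k -> k).
Hypothesis i1D : forall c, i1 (D c) = delta (i1 c).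
Hypothesis i2D : forall c, i2 (D c) = delta (i2 c).
Variable B : set U.
Hypothesis finB : finite_set B.
Hypothesis kB : forall c, term_ratio delta B (fun _ => i2 c).

Lemma meval_map_mpoly n (P : {mpoly k[n]}) h : (map_mpoly i2 P).@[h] = mmap i2 h P.
Proof.
elim/mpoly_gen_ind: P => [c|i|p q IHp IHq|p q IHp IHq].
- by rewrite map_mpolyC mevalC mmapC.
- by rewrite map_mpolyX mevalXU mmapX mmap1U.
- by rewrite mmapD rmorphD mevalD IHp IHq.
- by rewrite !rmorphM /= IHp IHq.
Qed.

Lemma map_mpoly_neq0 n (P : {mpoly k[n]}) : P != 0 -> map_mpoly i2 P != 0.
Proof.
apply: contraNneq => e; apply/eqP/mpolyP => m; apply: (fmorph_inj i2).
by rewrite -mcoeff_map_mpoly e !mcoeff0 rmorph0.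
Qed.

Lemma independent_jet0 w : independent_jet delta i1 0 w.
Proof.
move=> P; apply: contraNneq => e.
have [c ec] : exists c, P = c%:MP.
  elim/mpoly_gen_ind: P {e} => [c|[]//|p q [c ->] [d ->]|p q [c ->] [d ->]].
  - by exists c.
  - by exists (c + d); rewrite mpolyCD.
  - by exists (c * d); rewrite mpolyCM.
move: e; rewrite ec mmapC => /eqP; rewrite fmorph_eq0 => /eqP ->.
by rewrite mpolyC0.
Qed.

Lemma widen_mpoly n m (P : {mpoly k[n]}) : (n <= m)%N -> P != 0 ->
  exists2 Q : {mpoly k[m]}, Q != 0 &
    forall v, mmap i2 (jet delta v) Q = mmap i2 (jet delta v) P.
Proof.
move=> /subnK <- P0; elim: (m - n)%N => [|d [Q Q0 eQ]]; first by exists P.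
rewrite addSn; exists (mwiden Q) => [|v]; last by rewrite mmap_mwiden -eQ.
by rewrite -(inj_eq (@inj_mwiden _ k)) mwiden0 in Q0.
Qed.

(** Each nonzero differential polynomial of order less than n is avoided by some
    solution of the equation x^(n) = 0; saturation avoids all of them at once. *)
Lemma exists_independent : exists v, forall n, independent_jet delta i2 n v.
Proof.
pose N (F : U -> U) := exists n (P : {mpoly k[n]}), P != 0 /\
  F = (fun v => mmap i2 (jet delta v) P).
have [|||||v [_ Hv]] := @saturation_avoid U delta charU sat B (Eq (Zero U 1) (Zero U 1)) N finB.
- by move=> x /= [].
- by move=> F [n [P [P0 ->]]]; apply: term_ratio_mpoly.
- by exists 0%N, 1; rewrite oner_neq0; split=> //; apply/funext => v; rewrite rmorph1.
- move=> F G [n [P [P0 ->]]] [m [Q [Q0 ->]]].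
  have [P' P'0 eP] := widen_mpoly (leq_maxl n m) P0.
  have [Q' Q'0 eQ] := widen_mpoly (leq_maxr n m) Q0.
  exists (maxn n m), (P' * Q'); split; first exact: mulf_neq0.
  by apply/funext => v; rewrite rmorphM /= eP eQ.
- move=> F [n [P [P0 ->]]].
  have [||x [_ Px]] := blum_univariate blum (p := 'X) (g := map_mpoly i2 P).
  + by rewrite size_polyX.
  + exact: map_mpoly_neq0.
  by exists x; split=> //; rewrite -meval_map_mpoly.
by exists v => n P P0; apply: (Hv (fun v => mmap i2 (jet delta v) P)); exists n, P.
Qed.

(** Blum's axiom avoids one polynomial of lower order, saturation all of them. *)
Lemma exists_root n (p : {poly {mpoly k[n]}}) : (1 < size p)%N ->
  exists v, (map_poly (mmap i2 (jet delta v)) p).[iter n delta v] = 0 /\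
    independent_jet delta i2 n v.
Proof.
move=> sp.
have [t [s [tB sB ts]]] := term_ratio_mpoly kB (mmulti p).
pose N (F : U -> U) := exists P : {mpoly k[n]}, P != 0 /\ F = (fun v => mmap i2 (jet delta v) P).
have ptE v : holds delta (Eq t (Zero U 1)) [tuple v] <->
    (map_poly (mmap i2 (jet delta v)) p).[iter n delta v] = 0.
  have := ts v; rewrite mmap_mmulti => -[s0 ->] /=; split=> [->|/eqP]; first by rewrite mul0r.
  by rewrite mulf_eq0 invr_eq0 (negPf s0) orbF => /eqP.
have [|||||v [/ptE pv Hv]] := @saturation_avoid U delta charU sat B (Eq t (Zero U 1)) N finB.
- by rewrite /= setU0.
- by move=> F [P [P0 ->]]; apply: term_ratio_mpoly.
- by exists 1; rewrite oner_neq0; split=> //; apply/funext => v; rewrite rmorph1.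
- move=> F G [P [P0 ->]] [Q [Q0 ->]].
  exists (P * Q); split; first exact: mulf_neq0.
  by apply/funext => v; rewrite rmorphM.
- move=> F [P [P0 ->]].
  have inj : injective (map_mpoly (n := n) i2).
    move=> a b e; apply/eqP; rewrite -subr_eq0; apply: contraT => /map_mpoly_neq0.
    by rewrite rmorphB /= e subrr eqxx.
  have [||x [px Px]] := blum_univariate blum (p := map_poly (map_mpoly i2) p) (g := map_mpoly i2 P).
  + by rewrite size_map_inj_poly ?raddf0.
  + exact: map_mpoly_neq0.
  exists x; split; last by rewrite -meval_map_mpoly.
  apply/ptE; rewrite -px; congr (_.[_]); apply/polyP => i.
  by rewrite !coef_map /= meval_map_mpoly.
by exists v; split=> // P P0; apply: (Hv (fun v => mmap i2 (jet delta v) P)); exists P.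
Qed.

(** The forth step. Either w satisfies no differential relation over k, or there is a
    least n such that the n-th derivative is algebraic over the lower ones; v is then
    chosen to satisfy the same minimal relation and no relation of lower order. *)
Lemma extension w : exists v H, extends delta i1 i2 w v H.
Proof.
have [indw|dep] := pselect (forall n, independent_jet delta i1 n w).
  have [v indv] := exists_independent.
  by exists v; apply: (transcendental_extension der i1D i2D indw indv).
have [n indw depS] : exists2 n, independent_jet delta i1 n w & ~ independent_jet delta i1 n.+1 w.
  apply: contrapT => no; apply: dep; elim=> [|n IH]; first exact: independent_jet0.
  by apply: contrapT => dep; apply: no; exists n.
pose j1 := mmap i1 (jet delta w) : {mpoly k[n]} -> U.
have [p0 [p00 p0w]] : exists p : {poly {mpoly k[n]}}, p != 0 /\ (map_poly j1 p).[iter n delta w] = 0.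
  apply: contrapT => no; apply: depS => P P0; apply/eqP => Pw; apply: no.
  by exists (muni P); rewrite muni_eq0 P0; split=> //; rewrite -Pw mmap_muni.
have [p [pn0 pw] minp] := @ex_minimizer _ (fun p : {poly {mpoly k[n]}} => size p)
  (fun p => p != 0 /\ (map_poly j1 p).[iter n delta w] = 0) (ex_intro _ p0 (conj p00 p0w)).
have sp : (1 < size p)%N.
  rewrite ltnNge; apply/negP => sp1; move: pn0 pw; rewrite (size1_polyC sp1) map_polyC hornerC polyC_eq0.
  by move=> /indw /eqP + /=.
have [v [pv indv]] := exists_root sp.
exists v; apply: (algebraic_extension der charU i1D i2D indw indv pn0 pw pv) => q q0 qw.
exact: minp.
Qed.

End OneStep.
End Extension.

(** * Back and forth *)

Section BackAndForth.
Variables (U : fieldType) (delta : U -> U).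
Hypothesis der : is_derivation delta.
Hypothesis charU : [pchar U] =i pred0.
Hypothesis blum : blum_axioms delta.
Hypothesis sat : saturated delta.
Variable A : set U.
Hypothesis finA : finite_set A.

(** The same quantifier-free type over A. *)
Definition same_type n (x y : n.-tuple U) : Prop :=
  forall t : term U n, tparams t `<=` A -> teval delta x t = 0 <-> teval delta y t = 0.

Lemma same_type_sym n (x y : n.-tuple U) : same_type x y -> same_type y x.
Proof. by move=> H t tA; split=> /H; apply. Qed.

Definition type_rel n (x y : n.-tuple U) (a b : U) : Prop :=
  exists t : term U n, [/\ tparams t `<=` A, a = teval delta x t & b = teval delta y t].

Lemma type_rel_piso n (x y : n.-tuple U) : same_type x y -> ring_piso (type_rel x y).
Proof.
move=> xy; split.
- by exists (One U n); split=> //; apply: sub0set.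
- move=> a b c d [t [tA -> ->]] [s [sA -> ->]].
  by exists (Add t (Opp s)); split=> //=; rewrite subUset.
- move=> a b c d [t [tA -> ->]] [s [sA -> ->]].
  by exists (Mul t s); split=> //=; rewrite subUset.
- by move=> a b [t [tA -> ->]]; apply: xy.
Qed.

Lemma type_rel_der n (x y : n.-tuple U) : der_closed delta (type_rel x y).
Proof. by move=> a b [t [tA -> ->]]; exists (Der t). Qed.

(** Substitutes y for the variables. The result is a term in one variable so that
    elements of the coefficient field become constant functions for term_ratio. *)
Fixpoint close_term n (y : n.-tuple U) (t : term U n) : term U 1 :=
  match t with
  | Var i => Par 1 (tnth y i)
  | Par c => Par 1 c
  | Zero => Zero U 1
  | One => One U 1
  | Add t1 t2 => Add (close_term y t1) (close_term y t2)
  | Opp t1 => Opp (close_term y t1)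
  | Mul t1 t2 => Mul (close_term y t1) (close_term y t2)
  | Der t1 => Der (close_term y t1)
  end.

Lemma teval_close_term n (y : n.-tuple U) t v :
  teval delta [tuple v] (close_term y t) = teval delta y t.
Proof. by elim: t => //= [t -> s ->|t ->|t -> s ->|t ->]. Qed.

Lemma tparams_close_term n (y : n.-tuple U) t : tparams t `<=` A ->
  tparams (close_term y t) `<=` A `|` range (tnth y).
Proof.
elim: t => //= [i _ _ ->|c cA x ->|_|_|t IHt s IHs|t IHt s IHs].
- by right; exists i.
- by left; apply: cA.
- exact: sub0set.
- exact: sub0set.
- by rewrite !subUset => -[/IHt ? /IHs ?].
- by rewrite !subUset => -[/IHt ? /IHs ?].
Qed.

Lemma extends_same_type n (x y : n.-tuple U) (k : fieldType) (i1 i2 : {rmorphism k -> U}) w v H :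
  (forall a b, type_rel x y a b -> exists2 c, i1 c = a & i2 c = b) ->
  extends delta i1 i2 w v H -> same_type [tuple of w :: x] [tuple of v :: y].
Proof.
move=> lift [pH dH cH wv] t tA; apply: (piso_eq0 pH); elim: t tA => //=.
- move=> i _; case: (unliftP ord0 i) => [j ->|->]; last by rewrite !tnth0.
  rewrite !tnthS; have [c <- <-] : exists2 c, i1 c = tnth x j & i2 c = tnth y j; last exact: cH.
  by apply: lift; exists (Var U j); split=> //; apply: sub0set.
- move=> c cA; have [d e1 e2] : exists2 d, i1 d = c & i2 d = c; last by rewrite -{1}e1 -e2.
  by apply: lift; exists (Par n c).
- by move=> _; apply: piso0 pH.
- by move=> _; apply: piso1 pH.
- by move=> t IHt s IHs; rewrite subUset => -[/IHt ? /IHs ?]; apply: (pisoD pH).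
- by move=> t IHt /IHt; apply: (pisoN pH).
- by move=> t IHt s IHs; rewrite subUset => -[/IHt ? /IHs ?]; apply: (pisoM pH).
- by move=> t IHt /IHt; apply: dH.
Qed.

Lemma same_type_extend n (x y : n.-tuple U) : same_type x y ->
  forall w, exists v, same_type [tuple of w :: x] [tuple of v :: y].
Proof.
move=> xy w; have pG := type_rel_piso xy.
have [k [i1 [i2 [D [i1D i2D lift frac]]]]] := coefficient_field der pG (@type_rel_der _ x y).
have finB : finite_set (A `|` range (tnth y)).
  by rewrite finite_setU; split=> //; apply: finite_image; apply: finite_finset.
have kB c : term_ratio delta (A `|` range (tnth y)) (fun _ => i2 c).
  have [_ [_ [_ [_ [[t [tA _ ->]] [s [sA -> ->]] s0 _ ->]]]]] := frac c.
  exists (close_term y t), (close_term y s); split; [exact: tparams_close_term | exact: tparams_close_term |].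
  move=> v; rewrite !teval_close_term; split=> //.
  have rel : type_rel x y (teval delta x s) (teval delta y s) by exists s.
  exact: (piso_neq0 pG rel s0).
have [v [H ext]] := extension der charU blum sat i1D i2D finB kB w.
by exists v; apply: extends_same_type lift ext.
Qed.

(** This stands for quantifier elimination: a quantifier is crossed by extending the
    correspondence of x with y to a witness. *)
Lemma same_type_holds n (phi : formula U n) : fparams phi `<=` A ->
  forall x y, same_type x y -> holds delta phi x <-> holds delta phi y.
Proof.
elim: phi => {n} [n t s|n phi IH|n phi IH psi IH'|n phi IH] /=.
- rewrite subUset => -[tA sA] x y xy.
  have := xy (Add t (Opp s)); rewrite /= subUset => /(_ (conj tA sA)) H.
  by split=> /eqP; rewrite -subr_eq0 => /eqP /H /eqP; rewrite subr_eq0 => /eqP.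
- by move=> /IH {}IH x y /IH H; split=> nh /H.
- by rewrite subUset => -[/IH {}IH /IH' {}IH'] x y xy; rewrite (IH _ _ xy) (IH' _ _ xy).
- move=> /IH {}IH x y xy; split=> -[w hw].
    by have [v wv] := same_type_extend xy w; exists v; apply/(IH _ _ wv).
  have [v wv] := same_type_extend (same_type_sym xy) w.
  by exists v; apply/(IH _ _ wv).
Qed.
End BackAndForth.

(** * Polynomials as terms and as differential polynomials *)

Lemma finite_roots (U : fieldType) (q : {poly U}) : q != 0 ->
  finite_set [set z | q.[z] = 0].
Proof.
have [n] := ubnP (size q); elim: n q => // n IH q; rewrite ltnS => sq q0.
have [[a qa]|no] := pselect (exists a, root q a); last first.
  rewrite (_ : [set _ | _] = set0) // -subset0 => z qz; apply: no.
  by exists z; apply/eqP.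
have [r er] := factor_theorem _ _ qa.
have r0 : r != 0 by apply: contraNneq q0 => r0; rewrite er r0 mul0r.
apply: (@sub_finite_set _ _ ([set a] `|` [set z | r.[z] = 0])) => [z /=|].
  rewrite er hornerM hornerXsubC => /eqP; rewrite mulf_eq0 subr_eq0.
  by case/orP => /eqP; [right | left].
rewrite finite_setU; split; first exact: finite_set1.
by apply: IH => //; apply: leq_trans sq; rewrite er size_Mmonic ?monicXsubC // size_XsubC addn2.
Qed.

(** A finite set is contained in the set of roots of a nonzero polynomial. *)
Lemma infinite_avoids_roots (U : fieldType) (S : set U) :
  (forall q : {poly U}, q != 0 -> exists2 z, S z & q.[z] != 0) ->
  infinite_set [set [tuple z] | z in S].
Proof.
move=> av fin; have /finite_seqP [s es] : finite_set S.
  apply: sub_finite_set (finite_image (fun x : 1.-tuple U => tnth x ord0) fin).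
  by move=> z Sz; exists [tuple z] => //; exists z.
have [] := av (\prod_(a <- s) ('X - a%:P)); first by rewrite monic_neq0 ?monic_prod_XsubC.
move=> z; rewrite es /= => zs; rewrite -/(root _ z) => /negP; apply.
by rewrite root_prod_XsubC.
Qed.

Lemma poly_mpoly (k : fieldType) (q : {poly k}) n : exists2 Q : {mpoly k[n.+1]},
  q != 0 -> Q != 0 &
  forall (S : comNzRingType) (j : {rmorphism k -> S}) h, mmap j h Q = (map_poly j q).[h ord0].
Proof.
elim: n => [|n [Q Q0 eQ]].
  exists (mmulti (map_poly (@mpolyC 0 k) q)) => [|S j h].
    apply: contraNneq => e; have := muni_mmulti (map_poly (@mpolyC 0 k) q).
    rewrite e muni0 => /esym /eqP; rewrite -size_poly_eq0 size_map_inj_poly ?mpolyC0 //.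
      by rewrite size_poly_eq0.
    by move=> a b /(congr1 (mcoeff 0%MM)); rewrite !mcoeffC eqxx !mulr1.
  rewrite mmap_mmulti; congr (_.[_]); last by congr h; apply: val_inj.
  by apply/polyP => i; rewrite !coef_map /= mmapC.
exists (mwiden Q) => [q0|S j h].
  by have := Q0 q0; rewrite -(inj_eq (@inj_mwiden _ k)) mwiden0.
by rewrite mmap_mwiden eQ; congr (_.[h _]); apply: val_inj.
Qed.

Lemma meval_poly_mpoly (U : fieldType) n (Q : {mpoly U[n.+1]}) (q : {poly U}) h :
  (forall (S : comNzRingType) (j : {rmorphism U -> S}) h,
     mmap j h Q = (map_poly j q).[h ord0]) ->
  Q.@[h] = q.[h ord0].
Proof. by move=> e; rewrite /meval e map_poly_id. Qed.

Lemma size_linear_poly (L : idomainType) (a c : L) : a != 0 -> size (a *: 'X - c%:P) = 2.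
Proof.
move=> a0; have sX : size (a *: 'X : {poly L}) = 2 by rewrite size_scale ?size_polyX.
by rewrite size_polyDl sX // size_polyN; apply: leq_ltn_trans (size_polyC_leq1 _) _.
Qed.

Lemma tuple1E (T : Type) (x : 1.-tuple T) : x = [tuple tnth x ord0].
Proof. by apply: eq_from_tnth => i; rewrite !ord1. Qed.

Fixpoint poly_term (U : Type) (s : seq U) (t : term U 1) : term U 1 :=
  if s is c :: s' then Add (Mul (poly_term s' t) t) (Par 1 c) else Zero U 1.

Lemma teval_poly_term (U : fieldType) (delta : U -> U) (q : {poly U}) (t : term U 1) x :
  teval delta x (poly_term q t) = q.[teval delta x t].
Proof. by rewrite /horner; elim: (polyseq q) => //= c s ->. Qed.

Lemma finite_tparams (U : Type) n (t : term U n) : finite_set (tparams t).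
Proof.
elim: t => //= *; rewrite ?finite_setU //; [exact: finite_set1 ..].
Qed.

Lemma finite_fparams (U : Type) n (phi : formula U n) : finite_set (fparams phi).
Proof.
elim: phi => //= *; rewrite finite_setU //; split=> //; exact: finite_tparams.
Qed.

(** * The solution set *)

Section PoizatEquation.
Variables (C : closedFieldType) (U : fieldType) (delta : U -> U).
Variables (iota : {rmorphism C -> U}) (f : {fraction {poly C}}).
Hypothesis charC : [pchar C] =i pred0.
Hypothesis charU : [pchar U] =i pred0.
Hypothesis der : is_derivation delta.
Hypothesis blum : blum_axioms delta.
Hypothesis iota_const : forall c, delta (iota c) = 0.

Local Notation sol := (solution_set iota delta f).
Local Notation X := [set [tuple z] | z in sol].
Local Notation N := (map_poly iota (rnum f)).
Local Notation M := (map_poly iota (rden f)).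

Lemma map_rden_neq0 : M != 0. Proof. by rewrite map_poly_eq0 rden_neq0. Qed.

Lemma solution_setP z : sol z <-> [/\ M.[z] != 0, delta (delta z) * M.[z] = delta z * N.[z] & delta z != 0].
Proof.
split=> [[/eqP np -> z'0]|[M0 e z'0]].
  by split=> //; rewrite -mulrA divfK.
by split=> //; [apply/eqP | rewrite /reval mulrA -e mulfK].
Qed.

Definition solution_formula : formula U 1 :=
  let z := Var U ord0 in
  And (Not (Eq (poly_term M z) (Zero U 1)))
    (And (Eq (Mul (Der (Der z)) (poly_term M z)) (Mul (Der z) (poly_term N z)))
         (Not (Eq (Der z) (Zero U 1)))).

Lemma solution_formulaP x : holds delta solution_formula x <-> X x.
Proof.
have xE := tuple1E x.
rewrite /= !teval_poly_term /=; split=> [[/eqP M0 [e /eqP z'0]]|[z /solution_setP [M0 e z'0] <-]].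
  by exists (tnth x ord0); [apply/solution_setP | rewrite -xE].
by rewrite (_ : tnth _ _ = z) //; split; [apply/eqP | split=> //; apply/eqP].
Qed.

Lemma definable_solutions : definable delta X.
Proof.
by exists solution_formula; apply/seteqP; split=> x; rewrite /mkset; move/solution_formulaP.
Qed.

(** Blum's axiom for the equation M(x) x'' - x' N(x), of exact order 2, avoiding the
    product x' M(x) q(x), of order 1. *)
Lemma solution_avoids_roots (q : {poly U}) : q != 0 -> exists2 z, sol z & q.[z] != 0.
Proof.
move=> q0.
have [NX _ eN] := poly_mpoly N 1; have [MX MX0 eM] := poly_mpoly M 1.
have [QX QX0 eQ] := poly_mpoly q 1.
pose x1 : {mpoly U[2]} := 'X_ord_max.
have x10 : x1 != 0 by rewrite -muni_eq0 muni_X polyX_eq0.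
have [||z [pz gz]] := blum_univariate blum (p := MX *: 'X - (x1 * NX)%:P)
    (g := x1 * MX * QX).
- by rewrite size_linear_poly ?MX0 ?map_rden_neq0.
- by rewrite !mulf_neq0 ?MX0 ?QX0 ?map_rden_neq0.
move: gz; rewrite !mevalM mevalXU (meval_poly_mpoly _ eM) (meval_poly_mpoly _ eQ) !mulf_eq0 !negb_or.
rewrite /jet /= => /andP [/andP [z'0 M0] qz].
exists z => //; apply/solution_setP; split=> //.
move: pz; rewrite rmorphB /= map_polyZ map_polyX map_polyC hornerD hornerN hornerC hornerZ hornerX.
rewrite /= mevalM mevalXU (meval_poly_mpoly _ eM) (meval_poly_mpoly _ eN) /jet /= => /eqP.
by rewrite subr_eq0 mulrC => /eqP.
Qed.

Lemma infinite_solutions : infinite_set X.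
Proof. exact: infinite_avoids_roots solution_avoids_roots. Qed.

Lemma map_iota_const (p : {poly C}) : map_poly delta (map_poly iota p) = 0.
Proof. by apply/polyP => i; rewrite coef_map_der // coef_map /= iota_const coef0. Qed.

Section Integrable.
Variables m d : {poly C}.
Hypothesis m0 : m != 0.
Hypothesis d0 : d != 0.
Hypothesis fE : f = rderiv (tofrac m / tofrac d).

(** If f is the derivative of m / d then z' - (m / d)(z) is a first integral of the
    equation; this is its zero fibre. *)
Definition first_integral_fiber z :=
  [/\ sol z, (map_poly iota d).[z] != 0 & (map_poly iota d).[z] * delta z = (map_poly iota m).[z]].

(** Blum's axiom for the first-order equation d(x) x' = m(x); its solutions satisfy
    the second-order equation, as differentiating it shows. *)
Lemma fiber_avoids_roots (q : {poly U}) : q != 0 ->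
  exists2 z, first_integral_fiber z & q.[z] != 0.
Proof.
move=> q0.
have [mX mX0 em] := poly_mpoly (map_poly iota m) 0.
have [dX dX0 ed] := poly_mpoly (map_poly iota d) 0.
have [gX gX0 eg] := poly_mpoly (map_poly iota m * map_poly iota d * M * q) 0.
have mi0 : map_poly iota m != 0 by rewrite map_poly_eq0.
have di0 : map_poly iota d != 0 by rewrite map_poly_eq0.
have [||z [pz gz]] := blum_univariate blum (p := dX *: 'X - mX%:P) (g := gX).
- by rewrite size_linear_poly ?dX0.
- by apply: gX0; rewrite !mulf_neq0 ?map_rden_neq0.
move: gz; rewrite (meval_poly_mpoly _ eg) !hornerM !mulf_eq0 !negb_or /jet /=.
move=> /andP [/andP [/andP [mz dz] Mz] qz].
have ez : (map_poly iota d).[z] * delta z = (map_poly iota m).[z].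
  move: pz; rewrite rmorphB /= map_polyZ map_polyX map_polyC hornerD hornerN hornerC hornerZ hornerX.
  by rewrite /= (meval_poly_mpoly _ ed) (meval_poly_mpoly _ em) /jet /= => /eqP; rewrite subr_eq0 => /eqP.
exists z => //; split=> //; apply/solution_setP; split=> //; last first.
  by apply: contraNneq mz => z'0; rewrite -ez z'0 mulr0.
have eNM : rnum f * d ^+ 2 = (m^`() * d - m * d^`()) * rden f.
  have := rnum_rdenE f; rewrite {1}fE rderiv_frac // => /esym /eqP.
  by rewrite eqr_div ?tofrac_eq0 ?expf_neq0 ?rden_neq0 // -!tofracM tofrac_eq => /eqP.
have := congr1 (fun p => (map_poly iota p).[z]) eNM.
rewrite !(rmorphM, rmorphB, rmorphXn) /= !(hornerM, hornerD, hornerN, hornerXn) -!deriv_map.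
have := congr1 delta ez.
rewrite (derM der) !(der_horner der) !map_iota_const !horner0 !add0r.
move: dz ez; move: ((map_poly iota d).[z]) ((map_poly iota m).[z]) (delta z) (delta (delta z)).
move: ((map_poly iota d)^`().[z]) ((map_poly iota m)^`().[z]) => d' m' dd mm z' z''.
move=> dd0 <- e1 e2; apply: (mulIf (mulf_neq0 dd0 dd0)).
rewrite -[RHS]mulrA e2; set a := _.[z].
transitivity (dd * z'' * (a * dd)); first by ring.
have -> : dd * z'' = (m' - d' * z') * z' by rewrite mulrBl -e1 addrC addKr.
by ring.
Qed.

Definition fiber_formula : formula U 1 :=
  let z := Var U ord0 in
  And solution_formula
    (And (Not (Eq (poly_term (map_poly iota d) z) (Zero U 1)))
         (Eq (Mul (poly_term (map_poly iota d) z) (Der z)) (poly_term (map_poly iota m) z))).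

Lemma fiber_formulaP x :
  holds delta fiber_formula x <-> [set [tuple z] | z in first_integral_fiber] x.
Proof.
split=> [[/solution_formulaP [z solz <-]]|[z [solz /eqP dz ez] <-]].
  rewrite /= !teval_poly_term /= (_ : tnth _ _ = z) // => -[/eqP dz ez].
  by exists z.
split; first by apply/solution_formulaP; exists z.
by rewrite /= !teval_poly_term /= (_ : tnth _ _ = z).
Qed.
End Integrable.

(** Adding constants to an antiderivative n / d of f gives disjoint infinite fibres of
    the first integral. *)
Lemma integrable_not_strongly_minimal g : f = rderiv g -> ~ strongly_minimal delta X.
Proof.
have [n [d [d0 ->]]] := frac_exists g => fE [_ _ smX].
pose m c := n + c%:P * d.
have fEm c : f = rderiv (tofrac (m c) / tofrac d).
  rewrite fE !rderiv_frac // /m derivD derivM derivC mul0r add0r.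
  by congr (tofrac _ / _); ring.
(* n + c d may vanish for one constant c, whose fibre would have z' = 0 *)
have [c0 Hc0] : exists c0, forall c, c != c0 -> m c != 0.
  have [[c0 mc0]|no] := pselect (exists c0, m c0 = 0); last first.
    by exists 0 => c _; apply/eqP => mc; apply: no; exists c.
  exists c0 => c; apply: contraNneq => mc; move: (etrans mc (esym mc0)).
  by rewrite /m => /addrI /(mulIf d0) /polyC_inj ->.
have ne1 : c0 + 1 != c0 by rewrite -{2}[c0]addr0 (inj_eq (addrI _)) oner_eq0.
have ne2 : c0 + 1 + 1 != c0.
  rewrite -addrA -{2}[c0]addr0 (inj_eq (addrI _)) -[1 + 1]/(2%:R : C).
  by move/pcharf0P: charC => ->.
pose Y := [set [tuple z] | z in first_integral_fiber (m (c0 + 1)) d].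
have defY : definable delta Y.
  exists (fiber_formula (m (c0 + 1)) d); apply/seteqP.
  by split=> x; rewrite /mkset; move/fiber_formulaP.
have YX : Y `<=` X by move=> _ [z [solz _ _] <-]; exists z.
have [Yfin|Zfin] := smX Y defY YX.
- apply: infinite_avoids_roots Yfin => q q0.
  exact: (fiber_avoids_roots (Hc0 _ ne1) d0 (fEm _) q0).
apply: (@infinite_avoids_roots _ (first_integral_fiber (m (c0 + 1 + 1)) d)).
  by move=> q q0; apply: (fiber_avoids_roots (Hc0 _ ne2) d0 (fEm _) q0).
apply: sub_finite_set Zfin => _ [z [solz dz ez] <-]; split; first by exists z.
case=> y [_ _ ey] [yz]; move: ey; rewrite yz ez.
have -> : m (c0 + 1 + 1) = m (c0 + 1) + d by rewrite /m [(_ + 1)%:P]polyCD polyC1; ring.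
rewrite rmorphD hornerD /= => /eqP; rewrite -subr_eq0 addrAC subrr add0r.
by rewrite (negPf dz).
Qed.
End PoizatEquation.

(** * Strong minimality *)

Section StronglyMinimal.
Variables (C : closedFieldType) (U : fieldType) (delta : U -> U).
Variables (iota : {rmorphism C -> U}) (f : {fraction {poly C}}).
Hypothesis charC : [pchar C] =i pred0.
Hypothesis charU : [pchar U] =i pred0.
Hypothesis der : is_derivation delta.
Hypothesis blum : blum_axioms delta.
Hypothesis sat : saturated delta.
Hypothesis iota_const : forall c, delta (iota c) = 0.
Hypothesis no_primitive : forall g, f <> rderiv g.

Local Notation sol := (solution_set iota delta f).
Local Notation X := [set [tuple z] | z in sol].
Local Notation N := (map_poly iota (rnum f)).
Local Notation M := (map_poly iota (rden f)).

Section OverParameters.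
Variable A : set U.
Hypothesis finA : finite_set A.
Variables (k : fieldType) (j : {rmorphism k -> U}) (D : k -> k).
Hypothesis jD : forall c, j (D c) = delta (j c).
Hypothesis kA : forall c, term_ratio delta A (fun _ => j c).
Hypothesis Ak : forall a b, type_rel delta A [tuple] [tuple] a b -> exists2 c, j c = a & j c = b.
Variables Nk Mk : {poly k}.
Hypothesis eN : map_poly j Nk = N.
Hypothesis eM : map_poly j Mk = M.

(** There is no intermediate case: if z is transcendental over k then a relation
    between z and z' would give f an antiderivative. *)
Lemma solution_generic_or_algebraic z : sol z ->
  independent_jet delta j 2 z \/ exists2 q : {poly k}, q != 0 & (map_poly j q).[z] = 0.
Proof.
move=> solz; apply: contrapT => /not_orP [dep trz].
have {}trz (q : {poly k}) : q != 0 -> (map_poly j q).[z] != 0.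
  by move=> q0; apply/eqP => qz; apply: trz; exists q.
apply: dep => P P0; apply/eqP => Pz.
have [Q Q0 eQ] := mpoly2_poly j delta P0.
have [g fg] := order_one_integrable charC charU der iota_const jD eN eM solz trz Q0 (etrans (esym (eQ z)) Pz).
exact: no_primitive fg.
Qed.

(** For solutions z with z and z' independent over k, the equation itself, of degree 1
    in z'', is a minimal relation. *)
Lemma generic_solutions_same_type z1 z2 : sol z1 -> sol z2 ->
  independent_jet delta j 2 z1 -> independent_jet delta j 2 z2 ->
  same_type delta A [tuple z1] [tuple z2].
Proof.
move=> /solution_setP [M1 e1 _] /solution_setP [M2 e2 _] ind1 ind2.
have [NX _ eNX] := poly_mpoly Nk 1; have [MX MX0 eMX] := poly_mpoly Mk 1.
pose x1 : {mpoly k[2]} := 'X_ord_max.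
pose p : {poly {mpoly k[2]}} := MX *: 'X - (x1 * NX)%:P.
have Mk0 : Mk != 0 by rewrite -(map_poly_eq0 j) eM map_rden_neq0.
have sp : size p = 2 by rewrite size_linear_poly ?MX0.
have p0 : p != 0 by rewrite -size_poly_eq0 sp.
have pz z : delta (delta z) * M.[z] = delta z * N.[z] ->
    (map_poly (mmap j (jet delta z)) p).[iter 2 delta z] = 0.
  move=> e; rewrite rmorphB /= map_polyZ map_polyX map_polyC hornerD hornerN hornerC hornerZ hornerX.
  rewrite /= rmorphM /= mmapX mmap1U eNX eMX eN eM /jet /= mulrC e subrr.
  by [].
have minp (q : {poly {mpoly k[2]}}) : q != 0 ->
    (map_poly (mmap j (jet delta z1)) q).[iter 2 delta z1] = 0 -> (size p <= size q)%N.
  move=> q0 qz; rewrite sp ltnNge; apply/negP => q1; move: q0 qz.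
  by rewrite (size1_polyC q1) map_polyC hornerC polyC_eq0 => /ind1 /eqP.
have [H extH] := algebraic_extension der charU jD jD ind1 ind2 p0 (pz _ e1) (pz _ e2) minp.
have := extends_same_type Ak extH.
have tE z : [tuple of z :: [tuple]] = [tuple z] :> 1.-tuple U by apply: val_inj.
by rewrite !tE.
Qed.

(** The points are all algebraic over k. By saturation they are roots of one and the
    same polynomial, for otherwise some point would avoid all polynomials over k. *)
Lemma finite_without_generic (chi : formula U 1) : fparams chi `<=` A ->
  (forall z, holds delta chi [tuple z] -> sol z) ->
  (forall z, holds delta chi [tuple z] -> ~ independent_jet delta j 2 z) ->
  finite_set [set x | holds delta chi x].
Proof.
move=> chiA chisol nongen.
pose P (F : U -> U) := exists2 q : {poly k}, q != 0 & F = (fun v => (map_poly j q).[v]).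
have [Pex|] := pselect (forall F, P F -> exists v, holds delta chi [tuple v] /\ F v != 0).
  have PA F : P F -> term_ratio delta A F.
    move=> [q q0 ->]; have [Q _ eQ] := poly_mpoly q 0.
    have [t [s [tA sA e]]] := term_ratio_mpoly kA Q.
    by exists t, s; split=> // v; have := e v; rewrite eQ.
  have P1 : P (fun _ => 1).
    by exists 1; rewrite ?oner_neq0 //; apply/funext => v; rewrite rmorph1 hornerC.
  have PM F G : P F -> P G -> P (fun v => F v * G v).
    move=> [q q0 ->] [r r0 ->]; exists (q * r); first exact: mulf_neq0.
    by apply/funext => v; rewrite rmorphM hornerM.
  have [v [hv Hv]] := saturation_avoid charU sat finA chiA PA P1 PM Pex.
  have [gen|[q q0 qv]] := solution_generic_or_algebraic (chisol _ hv).
    by case: (nongen _ hv).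
  by have := Hv (fun v => (map_poly j q).[v]) (ex_intro2 _ _ q q0 erefl); rewrite qv eqxx.
move=> /existsNP [F /not_implyP [[q q0 ->] no]].
have roots z : holds delta chi [tuple z] -> (map_poly j q).[z] = 0.
  by move=> hz; apply: contrapT => /eqP qz; apply: no; exists z.
apply: (@sub_finite_set _ _ [set [tuple z] | z in [set z | (map_poly j q).[z] = 0]]).
  move=> x /= hx; have xE := tuple1E x.
  by exists (tnth x ord0) => //; apply: roots; rewrite -xE.
by apply: finite_image; apply: finite_roots; rewrite map_poly_eq0.
Qed.
End OverParameters.

Lemma lift_poly (k : fieldType) (j : {rmorphism k -> U}) (p : {poly U}) :
  (forall i, exists c, j c = p`_i) -> exists q, map_poly j q = p.
Proof.
move=> /(_ _)/cid ex; exists (\poly_(i < size p) projT1 (ex i)).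
apply/polyP => i; rewrite coef_map coef_poly; case: ltnP => [_|le].
  by case: (ex i).
by rewrite (nth_default _ le); exact: (rmorph0 j).
Qed.

Lemma not_integrable_strongly_minimal : strongly_minimal delta X.
Proof.
split; [exact: definable_solutions | exact: infinite_solutions |].
move=> Y [psi ->] YX.
(* 0 is included because it is a coefficient of N and M beyond their degrees *)
pose A := fparams psi `|` fparams (solution_formula iota f) `|` [set` (N : seq U)] `|` [set` (M : seq U)] `|` [set 0].
have finA : finite_set A.
  rewrite /A; have := finite_fparams psi; have := finite_fparams (solution_formula iota f).
  move: (fparams _) (fparams _) => B B' finB finB'.
  by rewrite !finite_setU; do !split; rewrite //; apply: finite_set1.
have sameA : same_type delta A [tuple] [tuple] by [].
have [k [i1 [i2 [D [i1D _ lift frac]]]]] :=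
  coefficient_field der (type_rel_piso sameA) (@type_rel_der _ delta A _ [tuple] [tuple]).
have rel_eq a b : type_rel delta A [tuple] [tuple] a b -> a = b.
  by move=> [t [tA -> ->]].
have kA c : term_ratio delta A (fun _ => i1 c).
  have [x [y [x' [y' [[t [tA ex _]] [s [sA ex' _]] s0 -> _]]]]] := frac c.
  rewrite {}ex {}ex' in s0 *.
  have AE : A `|` range (tnth ([tuple] : 0.-tuple U)) = A.
    by apply/setUidPl => z [[]].
  exists (close_term [tuple] t), (close_term [tuple] s).
  rewrite -{1 2}AE; split; [exact: tparams_close_term | exact: tparams_close_term |].
  by move=> v; rewrite !teval_close_term.
have Ak a b : type_rel delta A [tuple] [tuple] a b -> exists2 c, i1 c = a & i1 c = b.
  by move=> ab; have [c ca _] := lift _ _ ab; exists c; rewrite // ca (rel_eq _ _ ab).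
have in_k c : A c -> exists e, i1 e = c.
  move=> Ac; have [|e e1 _] := lift c c; last by exists e.
  by exists (Par 0 c); split=> // _ ->.
have coef_in_A (p : {poly U}) i : [set` (p : seq U)] `<=` A -> A p`_i.
  move=> pA; have [lt|le] := ltnP i (size p); first by apply: pA; apply: mem_nth.
  by right; rewrite /= nth_default.
have [Nk eN] : exists q, map_poly i1 q = N.
  by apply: lift_poly => i; apply: in_k; apply: coef_in_A => x Nx; left; left; right.
have [Mk eM] : exists q, map_poly i1 q = M.
  by apply: lift_poly => i; apply: in_k; apply: coef_in_A => x Mx; left; right.
have solz z : X [tuple z] -> sol z by move=> [y soly [<-]].
have fin := finite_without_generic finA i1D kA eN eM.
have psiA : fparams psi `<=` A by move=> x xp; do 4 left.
have solA : fparams (solution_formula iota f) `<=` A by move=> x xp; do 3 left; right.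
have [[z0 [hz0 gen0]]|no] := pselect (exists z, holds delta psi [tuple z] /\
    independent_jet delta i1 2 z); last first.
  left; apply: fin => // z hz; first by apply: solz; apply: YX.
  by move=> gen; apply: no; exists z.
right; pose chi := And (solution_formula iota f) (Not psi).
rewrite (_ : _ `\` _ = [set x | holds delta chi x]); last first.
  by apply/seteqP; split=> x [/solution_formulaP ? ?]; split=> //; apply/solution_formulaP.
apply: fin => [|z [/solution_formulaP/solz //]|z [/solution_formulaP/solz sz nz] gen].
  by rewrite /= subUset.
apply: nz; have sz0 : sol z0 by apply: solz; apply: YX.
have same := generic_solutions_same_type i1D Ak eN eM sz0 sz gen0 gen.
by apply/(same_type_holds der charU blum sat finA psiA same).
Qed.
End StronglyMinimal.

Theorem theorem3p1 (R : realType) (U : fieldType) (delta : U -> U)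
  (iota : {rmorphism R[i] -> U})
  (hDCF : model_of_DCF0 delta) (hsat : saturated delta)
  (hconst : range iota = [set c | delta c = 0])
  (f : {fraction {poly R[i]}}) :
  strongly_minimal delta [set [tuple z] | z in solution_set iota delta f] <->
  (forall g : {fraction {poly R[i]}}, f <> rderiv g).
Proof.
case: hDCF => charU der blum.
have charC : [pchar R[i]] =i pred0 by exact: Num.Theory.pchar_num.
have iota_const c : delta (iota c) = 0.
  have : range iota (iota c) by exists c.
  by rewrite hconst.
split=> [sm g fg|no_primitive].
  exact: (integrable_not_strongly_minimal charC der blum iota_const fg sm).
exact: (not_integrable_strongly_minimal charC charU der blum hsat iota_const no_primitive).
Qed.
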